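(* The following identity holds in the ring $\mathbb Q(z)[x][[\hbar^{1/2}]]$: $$\psi_\hbar(x,z)=e^{-\frac{\hbar}{24}}\Big\langle \exp\Big(\Big(y+\frac{xz}{1-z}\Big)\frac{\hbar^{1/2}}2\Big)\,\psi_\hbar\Big(y+\frac{xz}{1-z},\frac1{1-z}\Big)\Big\rangle_{y,\,1-z^{-1}}.$$
   Context: $\mathrm{Li}_0(z)=z/(1-z)$ and $\mathrm{Li}_{m-1}(z)=z\frac{d}{dz}\mathrm{Li}_m(z)$, so $\mathrm{Li}_m\in\mathbb Q(z)$ for $m\le 0$. $B_k$ are the Bernoulli numbers with $B_1=-\frac12$. Define $$\psi_\hbar(x,z)=\exp\Big(-\sum_{k,\ell\ge 0,\;k+\ell/2>1}\frac{B_k x^\ell\hbar^{k+\ell/2-1}}{\ell!\,k!}\mathrm{Li}_{2-k-\ell}(z)\Big)\in 1+\hbar^{1/2}\mathbb Q[z,(1-z)^{-1}][x][[\hbar^{1/2}]].$$ Formal Gaussian integration in one variable $y$ with respect to a nonzero $\lambda\in\mathbb Q(z)$: for a power series $f_\hbar(y)$ in $\hbar^{1/2}$ whose coefficients are polynomials in $y$ (with coefficients in $\mathbb Q(z)[x]$), $\langle f_\hbar(y)\rangle_{y,\lambda}=\exp\big(\frac1{2\lambda}\partial_y^2\big)f_\hbar(y)\big|_{y=0}$, applied coefficientwise in $\hbar^{1/2}$; thus $\langle y^n\rangle_{y,\lambda}=\lambda^{-n/2}(n-1)!!$ for even $n$ and $0$ for odd $n$. *)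

(* Defs.v *)
From HB Require Import structures.
From mathcomp Require Import all_boot all_order all_algebra.

Set Implicit Arguments.
Unset Strict Implicit.
Unset Printing Implicit Defensive.

Import GRing.Theory.
Local Open Scope ring_scope.
Local Open Scope quotient_scope.

(** Bernoulli numbers, with B_1 = -1/2: B_0 = 1 and
    \sum_(j < n.+1) 'C(n.+1, j) * B_j = 0 for n > 0.
    [bernoulli_seq n] lists B_0, ..., B_n. *)

Fixpoint bernoulli_seq (n : nat) : seq rat :=
  if n is m.+1 then
    let s := bernoulli_seq m in
    rcons s (- (\sum_(j < n) 'C(n.+1, j)%:R * s`_j) / n.+1%:R)
  else [:: 1].

Definition bernoulli (n : nat) : rat := (bernoulli_seq n)`_n.

(** The field Q(z). *)

Notation Qz := {fraction {poly rat}}.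

Definition z : Qz := tofrac 'X.

Definition ratQz : {rmorphism rat -> Qz} := @tofrac {poly rat} \o polyC.

Definition ddz (f : Qz) : Qz :=
  let n := \n_(repr f) in
  let d := \d_(repr f) in
  tofrac (n^`() * d - n * d^`()) / tofrac (d ^+ 2).

(** Substitution of s for the variable z in f. It is meaningful when s is not
    a pole of f, in particular for every nonconstant s. *)
Definition zsubst (s : Qz) (f : Qz) : Qz :=
  (map_poly ratQz \n_(repr f)).[s] / (map_poly ratQz \d_(repr f)).[s].

(** [Lineg m] is Li_{-m}. *)
Definition Lineg (m : nat) : Qz :=
  iter m (fun f => z * ddz f) (z / (1 - z)).

(** Formal power series in h = hbar^{1/2} over A: [f n] is the coefficient of
    h^n = hbar^{n/2}. *)

Definition fps (A : Type) : Type := nat -> A.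

Section PowerSeries.
Variable A : comUnitRingType.

Definition fps_monom (d : nat) (a : A) : fps A :=
  fun n => if n == d then a else 0.

Definition fps_mul (f g : fps A) : fps A :=
  fun n => \sum_(i < n.+1) f i * g (n - i)%N.

Definition fps_pow (f : fps A) (k : nat) : fps A :=
  iter k (fps_mul f) (fps_monom 0 1).

(** For f with zero constant term, f ^ k has no term in h^n when k > n. The
    integers k! are units in all the coefficient rings used below. *)
Definition fps_exp (f : fps A) : fps A :=
  fun n => \sum_(k < n.+1) (k`!%:R)^-1 * fps_pow f k n.

End PowerSeries.

(** Q(z)[x] is [{poly Qz}], with x = 'X. In the exponent of psi the coefficient
    of h^n collects the (k, l) with k + l/2 > 1 and k + l/2 - 1 = n/2, all of
    which satisfy k, l <= n + 2 and k + l >= 2. *)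

Definition psi_exponent : fps {poly Qz} := fun n =>
  - \sum_(k < n.+3) \sum_(l < n.+3 | ((2 < k.*2 + l) && (k.*2 + l == n.+2))%N)
      (ratQz (bernoulli k / (l`! * k`!)%:R) * Lineg (k + l - 2)) *: 'X^l.

Definition psi : fps {poly Qz} := fps_exp psi_exponent.

(** Q(z)[x][y] is [{poly {poly Qz}}], with y = 'X and x = 'X%:P.
    [psi_at X Z] is psi(X, Z), by coefficientwise substitution. *)

Definition psi_at (X : {poly {poly Qz}}) (Z : Qz) : fps {poly {poly Qz}} :=
  fun n => (map_poly (fun c => (zsubst Z c)%:P%:P) (psi n)).[X].

(** exp(1/(2 lambda) (d/dy)^2) on polynomials in y; the terms with
    2 j >= size p vanish. *)
Definition gauss_op (lambda : Qz) (p : {poly {poly Qz}}) : {poly {poly Qz}} :=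
  \sum_(j < size p) ((2 * lambda) ^- j / j`!%:R)%:P *: p^`(j.*2).

Definition gauss (lambda : Qz) (f : fps {poly {poly Qz}}) : fps {poly Qz} :=
  fun n => (gauss_op lambda (f n)).[0].

(** y + x z / (1 - z) *)
Definition yshift : {poly {poly Qz}} := 'X + ((z / (1 - z)) *: 'X)%:P.

(* Main.v *)
(** Write h = hbar^{1/2}, D = z d/dz and t = Li_0(z) = z / (1 - z). Up to the
    omitted terms, psi(x, z) is the quantum dilogarithm
    1 / (z e^{xh}; e^hbar)_oo, and it satisfies two linear equations:
      psi(x + h) = (1 - z e^{xh}) / (1 - z) exp(t (xh + hbar/2)) psi(x),
      d/dx psi = h D psi - h (Li_{-1}(z) x^2 / 2 - t / 2) psi.
    The first one comes from the generating function of the Bernoulli numbers.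
    The right-hand side of the theorem satisfies both as well: since
    1 - z^{-1} = - 1 / t, it equals e^{-hbar/24} G(t x), where G is the image
    of e^{xh/2} psi(x, 1 / (1 - z)) under exp(- t/2 (d/dx)^2), and conjugation
    by this operator turns multiplication by x into x - t d/dx. By the two
    equations, the lowest-order coefficient of the difference of the two sides
    is a constant of Q. It is 0, because at z = oo, where t = -1 and
    1 / (1 - z) = 0, both sides reduce to exp(hbar/12 - xh/2). *)

From HB Require Import structures.
Require Import Defs.
From mathcomp Require Import all_boot all_order all_algebra.
From mathcomp Require boolp.
From mathcomp Require Import ring zify.

Set Implicit Arguments.
Unset Strict Implicit.
Unset Printing Implicit Defensive.

Import GRing.Theory.
Local Open Scope ring_scope.

(** * Power series in hbar^{1/2} *)

(** Since Li_2 and Li_1 do not lie in Q(z), the product formula for the quantum dilogarithm is only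
    a guide: every statement must concern the truncated series. The substitute for analysis is the
    operator h d/dh. A series solving a suitable equation for it is determined by its constant term,
    and exponentials, shifts and Gaussian operators are all compared in this way. The shift equation
    alone determines a solution up to a factor independent of x; the second equation controls the
    dependence on z. Both are linear and commute with multiplication by h, so a nonzero difference
    of solutions could be divided by h until its constant term is nonzero, and only that term has to
    be studied. Neither equation sees the factor e^{-hbar/24}, which is fixed by the normalization
    alone. The point z = oo is chosen because at z = 0 the argument 1/(1-z) takes the value 1, a
    pole of Li_m for m <= 0. *)

Section SeriesRing.
Variable R : comNzRingType.

(** The wrapper around [nat -> R] gives power series a type of their own, on which the convolution
    product can be declared as a ring structure. *)
Record series := Series { coefs :> nat -> R }.

Implicit Types (f g u : series) (a b : R).

Lemma seriesP f g : f =1 g -> f = g.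
Proof. by case: f g => [f] [g] /= fg; congr Series; exact: boolp.funext. Qed.

HB.instance Definition _ := boolp.gen_eqMixin series.
HB.instance Definition _ := boolp.gen_choiceMixin series.

Definition series_add f g := Series (fun n => f n + g n).
Definition series_opp f := Series (fun n => - f n).
Definition series0 := Series (fun _ => 0).

Fact series_addA : associative series_add.
Proof. by move=> f g u; apply: seriesP => n; apply: addrA. Qed.
Fact series_addC : commutative series_add.
Proof. by move=> f g; apply: seriesP => n; apply: addrC. Qed.
Fact series_add0 : left_id series0 series_add.
Proof. by move=> f; apply: seriesP => n; apply: add0r. Qed.
Fact series_addN : left_inverse series0 series_opp series_add.
Proof. by move=> f; apply: seriesP => n; apply: addNr. Qed.

HB.instance Definition _ := GRing.isZmodule.Build series
  series_addA series_addC series_add0 series_addN.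

Definition series_const a := Series (fun n => if n == 0 then a else 0).
Definition series_mul f g :=
  Series (fun n => \sum_(i < n.+1) f i * g (n - i)%N).

(** Coefficient n of a product involves only coefficients up to n, so truncation to polynomials
    transfers commutativity and associativity from [{poly R}]. *)
Lemma series_mul_poly N f g n : (n < N)%N ->
  series_mul f g n = ((\poly_(i < N) f i) * (\poly_(i < N) g i))`_n.
Proof.
move=> nN; rewrite coefM /=; apply: eq_bigr => i _.
rewrite !coef_poly (leq_ltn_trans _ nN) ?leq_ord //.
by rewrite (leq_ltn_trans _ nN) ?leq_subr.
Qed.

Fact series_mulC : commutative series_mul.
Proof.
by move=> f g; apply: seriesP => n; rewrite !(@series_mul_poly n.+1) // mulrC.
Qed.

Fact series_mulA : associative series_mul.
Proof.
move=> f g u; apply: seriesP => n.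
pose F := \poly_(i < n.+1) f i; pose G := \poly_(i < n.+1) g i.
pose U := \poly_(i < n.+1) u i.
transitivity (F * (G * U))`_n; last rewrite mulrA.
  rewrite coefM; apply: eq_bigr => i _.
  by rewrite coef_poly ltn_ord (@series_mul_poly n.+1) // ltnS leq_subr.
rewrite coefM; apply: eq_bigr => i _.
by rewrite (@series_mul_poly n.+1) ?ltn_ord // coef_poly ltnS leq_subr.
Qed.

Lemma series_const_mulE a f n : series_mul (series_const a) f n = a * f n.
Proof.
by rewrite /= big_ord_recl subn0 big1 ?addr0 //= => i _; rewrite mul0r.
Qed.

Fact series_mul1 : left_id (series_const 1) series_mul.
Proof. by move=> f; apply: seriesP => n; rewrite series_const_mulE mul1r. Qed.

Fact series_mulD : left_distributive series_mul series_add.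
Proof.
move=> f g u; apply: seriesP => n /=.
by rewrite -big_split; apply: eq_bigr => i _; rewrite mulrDl.
Qed.

Fact series_1neq0 : series_const 1 != 0.
Proof.
by apply/eqP => /(congr1 (fun f : series => f 0)) /eqP; rewrite /= oner_eq0.
Qed.

HB.instance Definition _ := GRing.Zmodule_isComNzRing.Build series
  series_mulA series_mulC series_mul1 series_mulD series_1neq0.

Fact series_const_is_zmod_morphism : zmod_morphism series_const.
Proof. by move=> a b; apply: seriesP => -[|n] //=; rewrite subr0. Qed.
HB.instance Definition _ := GRing.isZmodMorphism.Build R series series_const
  series_const_is_zmod_morphism.

Fact series_const_is_monoid_morphism : monoid_morphism series_const.
Proof.
split=> // a b; apply: seriesP => n.
by rewrite [RHS]series_const_mulE; case: n => //= n; rewrite mulr0.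
Qed.
HB.instance Definition _ := GRing.isMonoidMorphism.Build R series series_const
  series_const_is_monoid_morphism.

Definition hvar := Series (fun n => (n == 1)%:R).
Definition tail f := Series (fun n => f n.+1).

Lemma coefsD f g n : (f + g) n = f n + g n. Proof. by []. Qed.
Lemma coefsN f n : (- f) n = - f n. Proof. by []. Qed.
Lemma coefsM f g n : (f * g) n = \sum_(i < n.+1) f i * g (n - i)%N.
Proof. by []. Qed.
Lemma coefsM0 f g : (f * g) 0 = f 0 * g 0.
Proof. by rewrite coefsM big_ord1. Qed.
Lemma coefsM1 f g : (f * g) 1 = f 0 * g 1 + f 1 * g 0.
Proof. by rewrite coefsM !big_ord_recr big_ord0 /= add0r. Qed.
Lemma coefsM2 f g : (f * g) 2 = f 0 * g 2 + f 1 * g 1 + f 2 * g 0.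
Proof. by rewrite coefsM !big_ord_recr big_ord0 /= add0r. Qed.
Lemma coefsCM a f n : (series_const a * f) n = a * f n.
Proof. exact: series_const_mulE. Qed.
Lemma coefsMn f k n : (f *+ k) n = f n *+ k.
Proof. by elim: k => // k IH; rewrite !mulrS coefsD IH. Qed.
Lemma hvarM0 f : (hvar * f) 0 = 0.
Proof. by rewrite coefsM0 mul0r. Qed.
Lemma hvarMS f n : (hvar * f) n.+1 = f n.
Proof.
rewrite coefsM 2!big_ord_recl /= mul0r add0r mul1r subn1 big1 ?addr0 //.
by move=> i _; rewrite mul0r.
Qed.

Lemma series_eta f : f = series_const (f 0) + hvar * tail f.
Proof.
by apply: seriesP => -[|n]; rewrite coefsD ?hvarM0 ?hvarMS /= ?addr0 ?add0r.
Qed.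

Lemma hvar_inj f g : hvar * f = hvar * g -> f = g.
Proof.
move=> fg; apply: seriesP => n.
by move/(congr1 (fun f : series => f n.+1)): fg; rewrite !hvarMS.
Qed.

(** The Euler operator h d/dh: a derivation that preserves degrees, which avoids the index shift of
    d/dh. *)
Definition theta f := Series (fun n => f n *+ n).

Lemma thetaE f n : theta f n = f n *+ n. Proof. by []. Qed.

Fact theta_is_zmod_morphism : zmod_morphism theta.
Proof. by move=> f g; apply: seriesP => n; apply: mulrnBl. Qed.
HB.instance Definition _ := GRing.isZmodMorphism.Build series series theta
  theta_is_zmod_morphism.

Lemma thetaM f g : theta (f * g) = theta f * g + f * theta g.
Proof.
apply: seriesP => n; rewrite coefsD !coefsM /= -sumrMnl -big_split /=.
apply: eq_bigr => i _; rewrite mulrnAl mulrnAr -mulrnDr.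
by rewrite subnKC // -ltnS ltn_ord.
Qed.

Lemma theta_const a : theta (series_const a) = 0.
Proof. by apply: seriesP => -[|n] //=; rewrite mul0rn. Qed.
Lemma theta_hvar : theta hvar = hvar.
Proof. by apply: seriesP => -[|[|n]] //=; rewrite mul0rn. Qed.

(** Non-expansive and contracting maps for the h-adic topology; a factor h turns the first kind into
    the second. *)
Definition causal (F : series -> series) := forall f g n,
  (forall i, (i <= n)%N -> f i = g i) -> F f n = F g n.
Definition contractive (F : series -> series) := forall f g n,
  (forall i, (i < n)%N -> f i = g i) -> F f n = F g n.

Lemma causal_id : causal id. Proof. by move=> f g n; apply. Qed.
Lemma causalD F G : causal F -> causal G -> causal (fun f => F f + G f).
Proof.
by move=> cF cG f g n fg; rewrite !coefsD (cF _ _ _ fg) (cG _ _ _ fg).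
Qed.
Lemma causalN F : causal F -> causal (fun f => - F f).
Proof. by move=> cF f g n fg; rewrite !coefsN (cF _ _ _ fg). Qed.
Lemma causalM u F : causal F -> causal (fun f => u * F f).
Proof.
move=> cF f g n fg; rewrite !coefsM; apply: eq_bigr => i _; congr (_ * _).
by apply: cF => j jn; apply: fg; apply: leq_trans jn (leq_subr _ _).
Qed.
Lemma causal_hvar F : causal F -> contractive (fun f => hvar * F f).
Proof.
move=> cF f g [|n] fg; rewrite ?hvarM0 // !hvarMS.
by apply: cF => i; apply: fg.
Qed.

Hypothesis torsionfree : forall n (a : R), a *+ n.+1 = 0 -> a = 0.

(** Coefficient n + 1 of the equation reads (n + 1) f_{n+1} = (F f)_{n+1}, and its right-hand side
    depends only on lower coefficients of f. *)
Lemma theta_uniq F f g : contractive F ->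
  theta f = F f -> theta g = F g -> f 0 = g 0 -> f = g.
Proof.
move=> cF tf tg fg0; apply: seriesP => n.
elim/ltn_ind: n => -[//|n] IH.
apply/eqP; rewrite -subr_eq0; apply/eqP/(@torsionfree n).
by rewrite mulrnBl -[f _ *+ _]/(theta f n.+1) tf (cF _ g) // -tg subrr.
Qed.

End SeriesRing.

Arguments hvar {R}.

Section SeriesMap.
Variables R R' : comNzRingType.

Definition smap (phi : R -> R') (f : series R) := Series (fun n => phi (f n)).

Lemma smapE (phi : R -> R') f n : smap phi f n = phi (f n).
Proof. by []. Qed.

Fact smap_is_zmod_morphism (phi : {additive R -> R'}) :
  zmod_morphism (smap phi).
Proof. by move=> f g; apply: seriesP => n; apply: raddfB. Qed.
HB.instance Definition _ (phi : {additive R -> R'}) :=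
  GRing.isZmodMorphism.Build (series R) (series R') (smap phi)
  (smap_is_zmod_morphism phi).

Fact smap_is_monoid_morphism (phi : {rmorphism R -> R'}) :
  monoid_morphism (smap phi).
Proof.
split=> [|f g]; apply: seriesP => n.
  by case: n => [|n] /=; rewrite ?rmorph1 ?rmorph0.
rewrite coefsM -[LHS]/(phi ((f * g) n)) coefsM rmorph_sum.
by apply: eq_bigr => i _; rewrite rmorphM.
Qed.
HB.instance Definition _ (phi : {rmorphism R -> R'}) :=
  GRing.isMonoidMorphism.Build (series R) (series R') (smap phi)
  (smap_is_monoid_morphism phi).

Lemma smap_hvar (phi : {additive R -> R'}) f :
  smap phi (hvar * f) = hvar * smap phi f.
Proof.
by apply: seriesP => -[|n]; rewrite smapE ?hvarM0 ?hvarMS ?raddf0.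
Qed.

Lemma smap_const (phi : {additive R -> R'}) a :
  smap phi (series_const a) = series_const (phi a).
Proof. by apply: seriesP => -[|n] //=; rewrite raddf0. Qed.

Lemma theta_smap (phi : {additive R -> R'}) f :
  theta (smap phi f) = smap phi (theta f).
Proof. by apply: seriesP => n /=; rewrite raddfMn. Qed.

End SeriesMap.

Lemma causal_smap (R : comNzRingType) (phi : R -> R) F :
  causal F -> causal (fun f => smap phi (F f)).
Proof. by move=> cF f g n fg /=; rewrite (cF _ _ _ fg). Qed.

Lemma smap_derivation (R : comNzRingType) (phi : {additive R -> R}) :
  (forall a b, phi (a * b) = phi a * b + a * phi b) ->
  forall f g, smap phi (f * g) = smap phi f * g + f * smap phi g.
Proof.
move=> phiM f g; apply: seriesP => n.
rewrite coefsD !coefsM -[LHS]/(phi ((f * g) n)) coefsM raddf_sum -big_split.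
by apply: eq_bigr => i _; rewrite phiM.
Qed.

(** * Exponentials of power series *)

Section SeriesExp.
Variable R : comUnitRingType.
Hypothesis natU : forall n, n.+1%:R \is a @GRing.unit R.

Lemma natU_torsionfree n (a : R) : a *+ n.+1 = 0 -> a = 0.
Proof.
by rewrite -mulr_natr => /(congr1 (fun b => b / n.+1%:R)); rewrite mul0r mulrK.
Qed.

Definition sexp (f : series R) := Series (fps_exp f).

Lemma fps_powE (f : series R) k : fps_pow f k =1 f ^+ k.
Proof.
elim: k => [|k IH] n; first by [].
by rewrite exprS coefsM; apply: eq_bigr => i _; rewrite -IH.
Qed.

Lemma coefsX_small (f : series R) k n : f 0 = 0 -> (n < k)%N -> (f ^+ k) n = 0.
Proof.
move=> f0; rewrite (series_eta f) f0 raddf0 add0r exprMn; move: (tail f ^+ k) => g.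
elim: k n => // k IH n nk; rewrite exprS -mulrA.
by case: n nk => [|n] nk; rewrite ?hvarM0 ?hvarMS ?IH.
Qed.

Lemma sexpE (f : series R) n N : f 0 = 0 -> (n < N)%N ->
  sexp f n = \sum_(k < N) (k`!%:R)^-1 * (f ^+ k) n.
Proof.
move=> f0 nN; rewrite /= /fps_exp.
rewrite (big_ord_widen N (fun k => (k`!%:R)^-1 * fps_pow f k n) nN) big_mkcond.
apply: eq_bigr => k _ /=; rewrite fps_powE; case: ifP => // /negbT.
by rewrite -leqNgt => nk; rewrite coefsX_small ?mulr0.
Qed.

Lemma sexp0 (f : series R) : sexp f 0 = 1.
Proof. by rewrite /= /fps_exp big_ord1 invr1 mul1r. Qed.

Lemma thetaX (f : series R) k :
  theta (f ^+ k.+1) = (theta f * f ^+ k) *+ k.+1.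
Proof.
elim: k => [|k IH]; first by rewrite expr1 expr0 mulr1.
rewrite exprS thetaM IH mulrnAr mulrCA -exprS -mulrS.
by [].
Qed.

Lemma factU k : k`!%:R \is a @GRing.unit R.
Proof. by rewrite -(prednK (fact_gt0 k)). Qed.

(** Termwise, h d/dh sends f^{k+1} / (k+1)! to theta f times f^k / k!. *)
Lemma theta_sexp (f : series R) : f 0 = 0 ->
  theta (sexp f) = theta f * sexp f.
Proof.
move=> f0; apply: seriesP => n; rewrite -[LHS]/(sexp f n *+ n).
(* The left-hand side takes one more term of the exponential: [theta] kills the term k = 0 and the
   others move down by one. *)
rewrite (@sexpE _ _ n.+2) // -sumrMnl big_ord_recl expr0 -mulrnAr.
rewrite -[_ *+ n]/(theta 1 n) (theta_const 1) mulr0 add0r coefsM.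
under [RHS]eq_bigr => i _.
  rewrite (@sexpE _ _ n.+1) ?ltnS ?leq_subr // mulr_sumr; over.
rewrite exchange_big; apply: eq_bigr => k _ /=; rewrite -mulrnAr.
rewrite -[_ *+ n]/(theta (f ^+ k.+1) n) thetaX coefsMn mulrnAr -mulrnAl.
rewrite coefsM mulr_sumr.
apply: eq_bigr => i _; rewrite mulrCA; congr (_ * (_ * _)).
rewrite factS natrM invrM ?natU ?factU // -mulrnAr.
by rewrite -[_^-1 *+ _]mulr_natr mulVr ?mulr1.
Qed.

(** Multiplication by [theta f], which has no constant term, is contractive. An exponential is thus
    recognized by its constant term and its logarithmic derivative. *)
Lemma sexp_uniq (f g : series R) : f 0 = 0 -> g 0 = 1 ->
  theta g = theta f * g -> g = sexp f.
Proof.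
move=> f0 g0 tg; apply: (@theta_uniq _ natU_torsionfree (fun u => theta f * u)) => //.
- rewrite (series_eta (theta f)) /= mulr0n raddf0 add0r => u v n uv.
  by rewrite -!mulrA; apply: (causal_hvar (causalM _ (@causal_id R))).
- exact: theta_sexp.
- by rewrite sexp0.
Qed.

Lemma sexpD (f g : series R) : f 0 = 0 -> g 0 = 0 ->
  sexp (f + g) = sexp f * sexp g.
Proof.
move=> f0 g0; symmetry; apply: sexp_uniq; first by rewrite coefsD f0 g0 addr0.
  by rewrite coefsM0 !sexp0 mulr1.
rewrite thetaM !theta_sexp // raddfD /=; ring.
Qed.

(** The defect u = phi (exp f) - phi f exp f solves theta u = theta f u, because [phi] acts on
    coefficients and so commutes with [theta]; its constant term is phi 1 = 0. *)
Lemma derivation_sexp (phi : {additive R -> R}) (f : series R) :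
    (forall a b, phi (a * b) = phi a * b + a * phi b) -> f 0 = 0 ->
  smap phi (sexp f) = smap phi f * sexp f.
Proof.
move=> phiM f0; have sM := smap_derivation phiM.
apply/eqP; rewrite -subr_eq0; apply/eqP.
apply: (@theta_uniq _ natU_torsionfree (fun u => theta f * u)).
- rewrite (series_eta (theta f)) /= mulr0n raddf0 add0r => u v n uv.
  by rewrite -!mulrA; apply: (causal_hvar (causalM _ (@causal_id R))).
- rewrite raddfB /= theta_smap theta_sexp // thetaM sM theta_sexp // theta_smap.
  by ring.
- by rewrite raddf0 mulr0.
- have /esym/eqP := phiM 1 1; rewrite !mulr1 mul1r -subr_eq0 addrK => /eqP phi1.
  by rewrite coefsD coefsN coefsM0 !smapE sexp0 phi1 f0 raddf0 mul0r subr0.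
Qed.

End SeriesExp.

(** * Shift, scaling and Gaussian operators *)

(** Iterating f = f_0 + h tail f reaches any given coefficient after finitely many steps, so no
    continuity has to be assumed. Identities between operators reduce to series constant in h. *)
Lemma hlinear_ext (R R' : comNzRingType) (F G : series R -> series R') :
    {morph F : f g / f + g} -> {morph G : f g / f + g} ->
    (forall f, F (hvar * f) = hvar * F f) ->
    (forall f, G (hvar * f) = hvar * G f) ->
    (forall a, F (series_const a) = G (series_const a)) ->
  F =1 G.
Proof.
move=> FD GD Fh Gh FG f; apply: seriesP => n.
elim: n f => [|n IH] f; rewrite (series_eta f) FD GD Fh Gh FG !coefsD.
  by rewrite !hvarM0.
by rewrite !hvarMS IH.
Qed.

Section Operators.
Variable K : fieldType.
Hypothesis char0 : forall n, n.+1%:R != 0 :> K.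

Local Notation P := {poly K}.
Local Notation S := (series {poly K}).

Lemma poly_natU n : n.+1%:R \is a @GRing.unit P.
Proof. by rewrite -(rmorph_nat polyC) rmorph_unit // unitfE. Qed.

Lemma fact_neq0 n : n`!%:R != 0 :> K.
Proof. by rewrite -(prednK (fact_gt0 n)). Qed.

Lemma poly_torsionfree n (p : P) : p *+ n.+1 = 0 -> p = 0.
Proof. exact: (natU_torsionfree poly_natU). Qed.

Definition kconst : {rmorphism K -> S} := @series_const P \o polyC.
Definition xvar : S := series_const 'X.
Definition dx : S -> S := smap (@deriv K).
HB.instance Definition _ := GRing.Additive.on dx.

Lemma kconstM_coef a (f : S) n : (kconst a * f) n = a%:P * f n.
Proof. exact: coefsCM. Qed.

Lemma kconst_inv2 : kconst 2^-1 * 2 = 1.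
Proof. by rewrite -(rmorph_nat kconst) -rmorphM mulVf ?rmorph1. Qed.

Lemma dxB f g : dx (f - g) = dx f - dx g.
Proof. exact: raddfB. Qed.
Lemma dxM f g : dx (f * g) = dx f * g + f * dx g.
Proof. by apply: smap_derivation => p q; exact: derivM. Qed.
Lemma dx_hvar f : dx (hvar * f) = hvar * dx f.
Proof. exact: smap_hvar. Qed.
Lemma dx_const p : dx (series_const p) = series_const p^`().
Proof. exact: smap_const. Qed.
Lemma dx_kconst a : dx (kconst a) = 0.
Proof. by rewrite dx_const derivC raddf0. Qed.
Lemma dx_xvar : dx xvar = 1.
Proof. by rewrite dx_const derivX rmorph1. Qed.
Lemma dx_kconstM a f : dx (kconst a * f) = kconst a * dx f.
Proof. by rewrite dxM dx_kconst mul0r add0r. Qed.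
Lemma theta_kconst a : theta (kconst a) = 0.
Proof. exact: theta_const. Qed.
Lemma theta_xvar : theta xvar = 0.
Proof. exact: theta_const. Qed.

Lemma causal_dx F : causal F -> causal (fun f => dx (F f)).
Proof. exact: causal_smap. Qed.

(** * The shift of x by c h *)

Section Shift.
Variable c : K.

(** Taylor's formula for p(x + c h). *)
Definition shift_poly (p : P) : S :=
  Series (fun n => (c ^+ n / n`!%:R) *: p^`(n)).

(** [shift f] is f(x + c hbar^{1/2}). *)
Definition shift (f : S) : S :=
  Series (fun n => \sum_(i < n.+1) shift_poly (f i) (n - i)%N).

Fact shift_is_zmod_morphism : zmod_morphism shift.
Proof.
move=> f g; apply: seriesP => n /=; rewrite -sumrB; apply: eq_bigr => i _.
by rewrite derivnB scalerBr.
Qed.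
HB.instance Definition _ := GRing.isZmodMorphism.Build S S shift
  shift_is_zmod_morphism.

Lemma shift_poly0 : shift_poly 0 = 0.
Proof. by apply: seriesP => n /=; rewrite linear0 scaler0. Qed.

Lemma shiftE f n : shift f n = \sum_(i < n.+1) shift_poly (f i) (n - i)%N.
Proof. by []. Qed.

Lemma shift_poly0E p : shift_poly p 0 = p.
Proof. by rewrite /= expr0 divr1 scale1r. Qed.

Lemma shift_coef0 f : shift f 0 = f 0.
Proof. by rewrite shiftE big_ord1 shift_poly0E. Qed.

Lemma shift_hvar f : shift (hvar * f) = hvar * shift f.
Proof.
apply: seriesP => -[|n]; first by rewrite shift_coef0 !hvarM0.
rewrite hvarMS shiftE big_ord_recl hvarM0 shift_poly0 add0r.
by apply: eq_bigr => i _; rewrite lift0 hvarMS subSS.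
Qed.

Lemma shift_constE p : shift (series_const p) = shift_poly p.
Proof.
apply: seriesP => n; rewrite shiftE big_ord_recl subn0 big1 ?addr0 // => i _.
by rewrite shift_poly0.
Qed.

Lemma theta_shift_poly p :
  theta (shift_poly p) = hvar * (kconst c * dx (shift_poly p)).
Proof.
apply: seriesP => -[|n]; rewrite ?hvarM0 ?hvarMS ?kconstM_coef //=.
rewrite derivZ mul_polyC scalerA scalerMnl; congr (_ *: _).
rewrite factS natrM exprS -mulr_natr; field.
by rewrite fact_neq0 -mulrS char0.
Qed.

(** The transport equation h df/dh = c h df/dx determines f from its value at h = 0.
    Multiplicativity and the commutation rules of [shift] follow from it. *)
Lemma theta_shift_uniq f g :
    theta f = hvar * (kconst c * dx f) -> theta g = hvar * (kconst c * dx g) ->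
  f 0 = g 0 -> f = g.
Proof.
apply: (theta_uniq poly_torsionfree (F := fun f => hvar * (kconst c * dx f))).
exact/causal_hvar/causalM/causal_dx/causal_id.
Qed.

Lemma shift_polyM p q : shift_poly (p * q) = shift_poly p * shift_poly q.
Proof.
apply: theta_shift_uniq; first exact: theta_shift_poly.
  by rewrite thetaM !theta_shift_poly dxM; ring.
by rewrite coefsM0 !shift_poly0E.
Qed.

Lemma shiftM f g : shift (f * g) = shift f * shift g.
Proof.
move: f; apply: hlinear_ext.
- by move=> u v; rewrite mulrDl raddfD.
- by move=> u v; rewrite raddfD mulrDl.
- by move=> u; rewrite -mulrA shift_hvar.
- by move=> u; rewrite shift_hvar mulrA.
move=> p; move: g; apply: hlinear_ext.
- by move=> u v; rewrite mulrDr raddfD.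
- by move=> u v; rewrite raddfD mulrDr.
- by move=> u; rewrite mulrCA shift_hvar.
- by move=> u; rewrite shift_hvar mulrCA.
by move=> q; rewrite -rmorphM !shift_constE shift_polyM.
Qed.

Lemma shift_kconst a : shift (kconst a) = kconst a.
Proof.
rewrite shift_constE; apply: seriesP => -[|n]; first exact: shift_poly0E.
by rewrite -[LHS]/(_ *: _^`(n.+1)) derivnC scaler0.
Qed.

Fact shift_is_monoid_morphism : monoid_morphism shift.
Proof. by split; [rewrite -(rmorph1 kconst) shift_kconst | exact: shiftM]. Qed.
HB.instance Definition _ := GRing.isMonoidMorphism.Build S S shift
  shift_is_monoid_morphism.

Lemma shift_one : shift 1 = 1.
Proof. exact: rmorph1. Qed.

Lemma shift_kconstM a f : shift (kconst a * f) = kconst a * shift f.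
Proof. by rewrite shiftM shift_kconst. Qed.

Lemma shift_var : shift hvar = hvar.
Proof. by rewrite -[X in shift X]mulr1 shift_hvar rmorph1 mulr1. Qed.

Lemma shift_xvar : shift xvar = xvar + kconst c * hvar.
Proof.
rewrite shift_constE; apply: seriesP => n; rewrite coefsD kconstM_coef.
rewrite -[shift_poly _ n]/(_ *: ('X)^`(n)).
case: n => [|[|n]]; first by rewrite expr0 divr1 scale1r mulr0 addr0.
  by rewrite derivn1 derivX expr1 divr1 mulr1 alg_polyC add0r.
by rewrite !derivSn derivX -(rmorph1 polyC) derivC linear0 scaler0 mulr0 addr0.
Qed.

Lemma dx_shift f : dx (shift f) = shift (dx f).
Proof.
move: f; apply: hlinear_ext.
- by move=> u v; rewrite !raddfD.
- by move=> u v; rewrite !raddfD.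
- by move=> u; rewrite shift_hvar dx_hvar.
- by move=> u; rewrite dx_hvar shift_hvar.
move=> p; rewrite dx_const !shift_constE.
by apply: seriesP => n; rewrite [LHS]derivZ -derivnS derivSn.
Qed.

End Shift.

(** Chain rule: h occurs both in the coefficients of f and in the shifted argument. *)
Lemma theta_shift c f :
  theta (shift c f) = shift c (theta f) + hvar * (kconst c * dx (shift c f)).
Proof.
(* [theta] does not commute with h, but its commutator with [shift c] does, which makes the
   reduction to constant series possible. *)
apply/eqP; rewrite addrC -subr_eq; apply/eqP; move: f; apply: hlinear_ext.
- by move=> u v; rewrite !raddfD /=; ring.
- by move=> u v; rewrite !raddfD /=; ring.
- by move=> u; rewrite shift_hvar !thetaM !theta_hvar raddfD /= !shift_hvar; ring.
- by move=> u; rewrite shift_hvar dx_hvar; ring.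
by move=> p; rewrite theta_const raddf0 subr0 shift_constE theta_shift_poly.
Qed.

Lemma shift_shift a b f : shift a (shift b f) = shift (a + b) f.
Proof.
move: f; apply: hlinear_ext.
- by move=> u v; rewrite !raddfD.
- by move=> u v; rewrite !raddfD.
- by move=> u; rewrite !shift_hvar.
- by move=> u; rewrite shift_hvar.
move=> p; apply: (@theta_shift_uniq (a + b)).
- rewrite theta_shift theta_shift theta_const raddf0 add0r shift_hvar.
  by rewrite shift_kconstM -!dx_shift rmorphD /=; ring.
- by rewrite theta_shift theta_const raddf0 add0r.
- by rewrite !shift_coef0.
Qed.

Lemma shift0 f : shift 0 f = f.
Proof.
move: f; apply: hlinear_ext => //; first by move=> u v; rewrite raddfD.
  by move=> u; rewrite shift_hvar.
move=> p; rewrite shift_constE; apply: seriesP => -[|n].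
  by rewrite shift_poly0E.
by rewrite /= exprS !mul0r scale0r.
Qed.

Section Scaling.
Variable t : K.

(** At y = 0 the variable y + t x of the average becomes t x, hence this rescaling. *)
Definition scale : S -> S := smap (comp_poly (t *: 'X)).
HB.instance Definition _ := GRing.RMorphism.on scale.

Lemma scaleE f n : scale f n = f n \Po (t *: 'X). Proof. by []. Qed.
Lemma scaleM f g : scale (f * g) = scale f * scale g.
Proof. exact: rmorphM. Qed.
Lemma scaleD f g : scale (f + g) = scale f + scale g. Proof. exact: raddfD. Qed.
Lemma scaleB f g : scale (f - g) = scale f - scale g. Proof. exact: raddfB. Qed.
Lemma scale_hvar f : scale (hvar * f) = hvar * scale f.
Proof. exact: smap_hvar. Qed.
Lemma scale_var : scale hvar = hvar.
Proof. by rewrite -[X in scale X]mulr1 scale_hvar rmorph1 mulr1. Qed.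
Lemma scale_kconst a : scale (kconst a) = kconst a.
Proof. by rewrite [LHS]smap_const /= comp_polyC. Qed.
Lemma scale_xvar : scale xvar = kconst t * xvar.
Proof. by rewrite [LHS]smap_const /= comp_polyX -mul_polyC rmorphM. Qed.
Lemma dx_scale f : dx (scale f) = kconst t * scale (dx f).
Proof.
apply: seriesP => n; rewrite kconstM_coef /= deriv_comp derivZ derivX.
by rewrite alg_polyC mulrC.
Qed.
Lemma theta_scale f : theta (scale f) = scale (theta f).
Proof. exact: theta_smap. Qed.

Lemma scale_shift c f : scale (shift (t * c) f) = shift c (scale f).
Proof.
move: f; apply: hlinear_ext.
- by move=> u v; rewrite !raddfD.
- by move=> u v; rewrite !raddfD.
- by move=> u; rewrite shift_hvar !scale_hvar.
- by move=> u; rewrite scale_hvar shift_hvar.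
move=> p; apply: (@theta_shift_uniq c).
- rewrite theta_scale theta_shift theta_const raddf0 add0r dx_scale scale_hvar.
  by rewrite scaleM scale_kconst rmorphM /=; ring.
- by rewrite theta_shift theta_scale theta_const !raddf0 add0r.
- by rewrite shift_coef0 !scaleE shift_coef0.
Qed.

End Scaling.

(** * The Gaussian operator *)

Section Gauss.
Variable t : K.

Definition tau_poly (p : P) : P :=
  \sum_(j < size p) ((- t / 2) ^+ j / j`!%:R) *: p^`(j.*2).

(** [tau] is exp(- t/2 (d/dx)^2). *)
Definition tau : S -> S := smap tau_poly.

Lemma tau_polyE N (p : P) : (size p <= N)%N ->
  tau_poly p = \sum_(j < N) ((- t / 2) ^+ j / j`!%:R) *: p^`(j.*2).
Proof.
move=> pN; rewrite /tau_poly.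
rewrite (big_ord_widen N (fun j => ((- t / 2) ^+ j / j`!%:R) *: p^`(j.*2)) pN).
rewrite big_mkcond; apply: eq_bigr => j _ /=; case: ifP => // /negbT.
rewrite -leqNgt => pj; rewrite derivn_poly0 ?scaler0 //.
by rewrite (leq_trans pj) // -addnn leq_addr.
Qed.

Fact tau_poly_is_zmod_morphism : zmod_morphism tau_poly.
Proof.
move=> p q; pose N := maxn (size p) (size q).
rewrite !(@tau_polyE N) ?leq_maxl ?leq_maxr //; last first.
  by rewrite (leq_trans (size_polyD _ _)) // size_polyN.
by rewrite -sumrB; apply: eq_bigr => j _; rewrite derivnB scalerBr.
Qed.
HB.instance Definition _ := GRing.isZmodMorphism.Build P P tau_poly
  tau_poly_is_zmod_morphism.
HB.instance Definition _ := GRing.Additive.on tau.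

Lemma tau_polyC a : tau_poly a%:P = a%:P.
Proof.
rewrite (@tau_polyE 1) ?size_polyC ?leq_b1 //.
by rewrite big_ord1 expr0 divr1 scale1r.
Qed.

Lemma leq_size_deriv (p : P) : (size p^`() <= size p)%N.
Proof.
by have [->|/lt_size_deriv/ltnW //] := eqVneq p 0; rewrite linear0.
Qed.

Lemma tau_poly_deriv (p : P) : tau_poly p^`() = (tau_poly p)^`().
Proof.
rewrite (tau_polyE (leq_size_deriv p)).
rewrite raddf_sum; apply: eq_bigr => j _ /=.
by rewrite derivZ -derivnS -derivSn.
Qed.

(** By Leibniz the derivative of order 2j of x p is x p^(2j) + 2j p^(2j-1), and the factor 2j turns
    (-t/2)^j / j! into -t times the preceding coefficient. *)
Lemma tau_polyMX (p : P) :
  tau_poly (p * 'X) = tau_poly p * 'X - t *: (tau_poly p)^`().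
Proof.
rewrite -tau_poly_deriv; pose N := (size p).+1.
have pN : (size p <= N)%N by exact: leqW.
have pXN : (size (p * 'X)%R <= N)%N.
  by rewrite (leq_trans (size_polyMleq _ _)) // size_polyX addn2.
have dpN : (size p^`() <= size p)%N by exact: leq_size_deriv.
rewrite (tau_polyE pXN) (tau_polyE pN) (tau_polyE dpN) !big_ord_recl /= expr0.
rewrite divr1 !scale1r mulrDl -addrA; congr (_ + _).
rewrite mulr_suml scaler_sumr -sumrB; apply: eq_bigr => j _.
rewrite /= add0n -!derivnS -[(p * 'X)%R]addr0 -(raddf0 polyC) derivnMXaddC.
rewrite scalerDr addrC -scalerAl; congr (_ + _).
rewrite -derivSn -scaler_nat !scalerA -scaleNr; congr (_ *: _).
rewrite factS natrM exprS -addnn -addSn -addnS natrD; field.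
by rewrite fact_neq0 -mulrS char0 (char0 1).
Qed.

Lemma tauE f n : tau f n = tau_poly (f n). Proof. by []. Qed.
Lemma tauD f g : tau (f + g) = tau f + tau g. Proof. exact: raddfD. Qed.
Lemma tauB f g : tau (f - g) = tau f - tau g. Proof. exact: raddfB. Qed.
Lemma tau_hvar f : tau (hvar * f) = hvar * tau f.
Proof. exact: smap_hvar. Qed.
Lemma tau_const p : tau (series_const p) = series_const (tau_poly p).
Proof. exact: smap_const. Qed.
Lemma tau_kconst a : tau (kconst a) = kconst a.
Proof. by rewrite tau_const tau_polyC. Qed.
Lemma dx_tau f : dx (tau f) = tau (dx f).
Proof. by apply: seriesP => n; rewrite [RHS]tau_poly_deriv. Qed.
Lemma tau_xvar f : tau (xvar * f) = xvar * tau f - kconst t * dx (tau f).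
Proof.
apply: seriesP => n; rewrite coefsD coefsN kconstM_coef.
rewrite -[LHS]/(tau_poly ((xvar * f) n)) !coefsCM -[tau f n]/(tau_poly (f n)).
rewrite -[dx _ n]/((tau_poly (f n))^`()) mul_polyC !['X * _]mulrC.
exact: tau_polyMX.
Qed.
Lemma theta_tau f : theta (tau f) = tau (theta f).
Proof. exact: theta_smap. Qed.
Lemma tau_kconstM a f : tau (kconst a * f) = kconst a * tau f.
Proof.
apply: seriesP => n; rewrite kconstM_coef !smapE kconstM_coef !mul_polyC.
rewrite /tau_poly; have [->|a0] := eqVneq a 0.
  by rewrite !scale0r size_poly0 big_ord0.
rewrite size_scale // scaler_sumr; apply: eq_bigr => j _.
by rewrite derivnZ !scalerA mulrC.
Qed.

End Gauss.

Definition gexp_arg a b : S := hvar * (kconst a * xvar + kconst b * hvar).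
(** All exponential factors of the proof have the form exp(a x h + b hbar), a family stable under
    products, shifts, rescaling and, up to a shift operator, Gaussian conjugation. *)
Definition gexp a b : S := sexp (gexp_arg a b).

Lemma gexp_arg0 a b : gexp_arg a b 0 = 0.
Proof. exact: hvarM0. Qed.

Lemma gexp0 a b : gexp a b 0 = 1.
Proof. exact: sexp0. Qed.

Lemma theta_gexp_arg a b : theta (gexp_arg a b) =
  hvar * (kconst a * xvar + kconst b * hvar + kconst b * hvar).
Proof.
rewrite thetaM theta_hvar raddfD /= !thetaM theta_hvar !theta_kconst theta_xvar.
ring.
Qed.

Lemma theta_gexp a b : theta (gexp a b) =
  hvar * (kconst a * xvar + kconst b * hvar + kconst b * hvar) * gexp a b.
Proof. by rewrite theta_sexp ?gexp_arg0 ?theta_gexp_arg //; exact: poly_natU. Qed.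

Lemma gexp_uniq a b (f : S) : f 0 = 1 ->
  theta f = hvar * (kconst a * xvar + kconst b * hvar + kconst b * hvar) * f ->
  f = gexp a b.
Proof.
move=> f0 tf; apply: (sexp_uniq poly_natU) => //; first exact: gexp_arg0.
by rewrite theta_gexp_arg.
Qed.

Lemma gexpD a b a' b' : gexp a b * gexp a' b' = gexp (a + a') (b + b').
Proof.
rewrite -(sexpD poly_natU) ?gexp_arg0 //; congr sexp.
by rewrite /gexp_arg !rmorphD; ring.
Qed.

Lemma eq_gexp a b a' b' : a = a' -> b = b' -> gexp a b = gexp a' b'.
Proof. by move=> -> ->. Qed.

Lemma gexp00 : gexp 0 0 = 1.
Proof.
by symmetry; apply: gexp_uniq => //; rewrite theta_const rmorph0; ring.
Qed.

Lemma dx_var : dx hvar = 0.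
Proof. by rewrite -[hvar]mulr1 dx_hvar -(rmorph1 kconst) dx_kconst mulr0. Qed.

Lemma dx_gexp a b : dx (gexp a b) = hvar * kconst a * gexp a b.
Proof.
have -> : dx (gexp a b) = dx (gexp_arg a b) * gexp a b.
  by apply: (derivation_sexp poly_natU); [exact: derivM | exact: gexp_arg0].
congr (_ * _); rewrite dx_hvar raddfD /= !dx_kconstM dx_xvar dx_var; ring.
Qed.

Lemma shift_gexp c a b : shift c (gexp a b) = gexp a (b + a * c).
Proof.
apply: gexp_uniq; first by rewrite shift_coef0 gexp0.
rewrite theta_shift dx_shift dx_gexp theta_gexp !(shiftM, raddfD) /=.
rewrite !(shiftM, shift_kconst, shift_var, shift_xvar) rmorphM; ring.
Qed.

Lemma scale_gexp t a b : scale t (gexp a b) = gexp (a * t) b.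
Proof.
apply: gexp_uniq; first by rewrite scaleE gexp0 rmorph1.
rewrite theta_scale theta_gexp !(scaleM, raddfD) /=.
rewrite !(scaleM, scale_kconst, scale_var, scale_xvar) rmorphM; ring.
Qed.

(* Conjugation by exp(- t/2 (d/dx)^2) turns x into x - t d/dx; by the
   Baker-Campbell-Hausdorff formula the exponential exp(a (x - t d/dx) h) is
   exp(- a^2 t h^2 / 2) exp(a x h) exp(- a t h d/dx). *)
Lemma tau_gexp t a b f :
  tau t (gexp a b * f) =
    gexp a (b - a ^+ 2 * t / 2) * shift (- (a * t)) (tau t f).
Proof.
move: f; apply: hlinear_ext.
- by move=> u v; rewrite mulrDr raddfD.
- by move=> u v; rewrite !raddfD mulrDr.
- by move=> u; rewrite mulrCA tau_hvar.
- by move=> u; rewrite tau_hvar shift_hvar mulrCA.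
move=> p.
(* The Euler equation of exp(a x h + b hbar), with x replaced by its conjugate x - t d/dx; both
   sides satisfy it. *)
pose F g : S := hvar * (kconst a * (xvar * g - kconst t * dx g)
  + (kconst b + kconst b) * (hvar * g)).
apply: (theta_uniq poly_torsionfree (F := F)).
- apply: causal_hvar; apply: causalD; apply: causalM; last first.
    exact/causalM/causal_id.
  apply: causalD; first exact/causalM/causal_id.
  exact/causalN/causalM/causal_dx/causal_id.
- rewrite theta_tau thetaM theta_const mulr0 addr0 theta_gexp /F.
  set g := gexp a b * _.
  have -> : hvar * (kconst a * xvar + kconst b * hvar + kconst b * hvar) *
      gexp a b * series_const p =
    hvar * (kconst a * (xvar * g) + kconst b * (hvar * g) + kconst b * (hvar * g)).
    by rewrite /g; ring.
  rewrite tau_hvar !raddfD /= !tau_kconstM tau_xvar !tau_hvar; ring.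
- rewrite thetaM theta_gexp theta_shift theta_tau theta_const !raddf0 add0r /F.
  rewrite dxM dx_gexp; move: (shift _ _) => g.
  rewrite !(rmorphN, rmorphM, rmorphB, rmorphXn) /=.
  have -> : kconst b + kconst b = kconst b * 2 by ring.
  set G := gexp _ _; set h := hvar.
  have e2 : kconst 2^-1 * 2 = 1 := kconst_inv2.
  have -> : kconst a ^+ 2 * kconst t * kconst 2^-1 =
    kconst 2^-1 * (kconst a ^+ 2 * kconst t) by ring.
  set z := kconst 2^-1 * _; have zz : z + z = kconst a ^+ 2 * kconst t.
    by rewrite -mulr2n -mulr_natr mulrAC e2 mul1r.
  transitivity (h * ((kconst a * xvar + (kconst b + kconst b) * h
      - (z + z) * h) * (G * g)
     - kconst a * kconst t * G * dx g)); first by ring.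
  by rewrite zz; ring.
- by rewrite tauE !coefsM0 !gexp0 !mul1r shift_coef0 tauE.
Qed.

(** Both operators are series in d/dx with coefficients free of x. *)
Lemma shift_tau t c f : tau t (shift c f) = shift c (tau t f).
Proof.
move: f; apply: hlinear_ext.
- by move=> u v; rewrite !raddfD.
- by move=> u v; rewrite !raddfD.
- by move=> u; rewrite shift_hvar tau_hvar.
- by move=> u; rewrite tau_hvar shift_hvar.
move=> p; apply: (@theta_shift_uniq c).
- rewrite theta_tau theta_shift theta_const raddf0 add0r tau_hvar tau_kconstM.
  by rewrite dx_tau.
- by rewrite theta_shift theta_tau theta_const !raddf0 add0r.
- by rewrite shift_coef0 !tauE shift_coef0.
Qed.

(** * Morphisms and derivations of the coefficient field *)

Section KMaps.

Section Morphism.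
Variable phi : {rmorphism K -> K}.

Definition kmap : S -> S := smap (map_poly phi).
HB.instance Definition _ := GRing.RMorphism.on kmap.

Lemma kmap_kconst a : kmap (kconst a) = kconst (phi a).
Proof. by rewrite [LHS]smap_const /= map_polyC. Qed.
Lemma kmap_xvar : kmap xvar = xvar.
Proof. by rewrite [LHS]smap_const /= map_polyX. Qed.
Lemma kmap_hvar f : kmap (hvar * f) = hvar * kmap f.
Proof. exact: smap_hvar. Qed.
Lemma kmap_var : kmap hvar = hvar.
Proof. by rewrite -[X in kmap X]mulr1 kmap_hvar rmorph1 mulr1. Qed.
Lemma kmapM f g : kmap (f * g) = kmap f * kmap g.
Proof. exact: rmorphM. Qed.
Lemma theta_kmap f : theta (kmap f) = kmap (theta f).
Proof. exact: theta_smap. Qed.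
Lemma dx_kmap f : dx (kmap f) = kmap (dx f).
Proof. by apply: seriesP => n; rewrite [LHS]deriv_map. Qed.

Lemma shift1_kmap f : shift 1 (kmap f) = kmap (shift 1 f).
Proof.
move: f; apply: hlinear_ext.
- by move=> u v; rewrite !raddfD.
- by move=> u v; rewrite !raddfD.
- by move=> u; rewrite kmap_hvar shift_hvar.
- by move=> u; rewrite shift_hvar kmap_hvar.
move=> p; apply: (@theta_shift_uniq 1).
- by rewrite theta_shift theta_kmap theta_const !raddf0 add0r.
- rewrite theta_kmap theta_shift theta_const raddf0 add0r kmap_hvar kmapM.
  by rewrite kmap_kconst rmorph1 dx_kmap.
- by rewrite shift_coef0 !smapE shift_coef0.
Qed.

Lemma kmap_gexp a b : kmap (gexp a b) = gexp (phi a) (phi b).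
Proof.
apply: gexp_uniq; first by rewrite smapE gexp0 rmorph1.
rewrite theta_kmap theta_gexp !(kmapM, raddfD) /=.
by rewrite !(kmapM, kmap_kconst, kmap_var, kmap_xvar).
Qed.

End Morphism.

Section Derivation.
Variable d : {additive K -> K}.
Hypothesis dM : forall a b, d (a * b) = d a * b + a * d b.

Definition kder : S -> S := smap (map_poly d).
HB.instance Definition _ := GRing.Additive.on kder.

Lemma derivation1 : d 1 = 0.
Proof.
by have /esym/eqP := dM 1 1; rewrite !mulr1 mul1r -subr_eq0 addrK => /eqP.
Qed.

Lemma map_polyM_derivation (p q : P) :
  map_poly d (p * q) = map_poly d p * q + p * map_poly d q.
Proof.
apply/polyP => n; rewrite coefD !coefM coef_map coefM raddf_sum -big_split.
by apply: eq_bigr => i _; rewrite !coef_map dM.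
Qed.

Lemma kderM f g : kder (f * g) = kder f * g + f * kder g.
Proof. by apply: smap_derivation => p q; exact: map_polyM_derivation. Qed.
Lemma kder_hvar f : kder (hvar * f) = hvar * kder f.
Proof. exact: smap_hvar. Qed.
Lemma kder_kconst a : kder (kconst a) = kconst (d a).
Proof. by rewrite [LHS]smap_const /= map_polyC. Qed.
Lemma map_polyX_derivation : map_poly d 'X = 0.
Proof.
apply/polyP => n; rewrite coef_map coefX coef0.
by case: eqP; rewrite ?derivation1 ?raddf0.
Qed.
Lemma kder_xvar : kder xvar = 0.
Proof. by rewrite [LHS]smap_const /= map_polyX_derivation raddf0. Qed.
Lemma kder_var : kder hvar = 0.
Proof.
rewrite -[hvar]mulr1 kder_hvar -(rmorph1 kconst) kder_kconst derivation1.
by rewrite raddf0 mulr0.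
Qed.
Lemma kder_gexp a b : kder (gexp a b) =
  hvar * (kconst (d a) * xvar + kconst (d b) * hvar) * gexp a b.
Proof.
have -> : kder (gexp a b) = kder (gexp_arg a b) * gexp a b.
  apply: (derivation_sexp poly_natU); last exact: gexp_arg0.
  exact: map_polyM_derivation.
congr (_ * _); rewrite kder_hvar raddfD /= !kderM !kder_kconst kder_xvar kder_var.
ring.
Qed.

(** Since d (t x) = e t x, the chain rule adds e times the operator x d/dx applied to p(t x). *)
Lemma map_poly_scale_derivation t e p : d t = e * t ->
  map_poly d (p \Po (t *: 'X)) =
    map_poly d p \Po (t *: 'X) + e *: 'X * (p \Po (t *: 'X))^`().
Proof.
move=> dt; elim/poly_ind: p => [|p c IH].
  by rewrite raddf0 linear0 raddf0 linear0 mulr0 addr0.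
rewrite comp_poly_MXaddC !raddfD /= !map_polyM_derivation IH.
rewrite map_polyX_derivation !map_polyC /= mulr0 addr0 !comp_polyM comp_polyC.
rewrite comp_polyX.
have -> : map_poly d (t *: 'X) = (e * t) *: 'X.
  rewrite -mul_polyC map_polyM_derivation map_polyX_derivation mulr0 addr0.
  by rewrite map_polyC /= dt mul_polyC.
rewrite derivM derivC derivZ derivX -!mul_polyC rmorphM /=; ring.
Qed.

Lemma kder_scale t e f : d t = e * t ->
  kder (scale t f) = scale t (kder f) + kconst e * xvar * dx (scale t f).
Proof.
move=> dt; apply: seriesP => n; rewrite coefsD -mulrA kconstM_coef coefsCM.
by rewrite [LHS](map_poly_scale_derivation _ dt) -scalerAl mul_polyC.
Qed.

Lemma map_poly_deriv_derivation (p : P) : map_poly d p^`() = (map_poly d p)^`().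
Proof. by apply/polyP => n; rewrite coef_map !coef_deriv coef_map raddfMn. Qed.

(** The exponent -t/2 (d/dx)^2 depends on t, so differentiating the operator itself contributes -(d
    t)/2 (d/dx)^2. The induction on the degree rests on the commutation rule with x. *)
Lemma map_poly_tau_derivation t (p : P) :
  map_poly d (tau_poly t p) =
    tau_poly t (map_poly d p) - (d t / 2) *: (tau_poly t p)^`()^`().
Proof.
elim/poly_ind: p => [|p c IH].
  have d0 : map_poly d 0 = 0 := raddf0 (map_poly d).
  have t0 : tau_poly t 0 = 0 := raddf0 (tau_poly t).
  by rewrite !(d0, t0, deriv0) scaler0 subr0.
rewrite !raddfD /= tau_polyMX tau_polyC !map_polyM_derivation !map_polyC /=.
rewrite tau_polyC map_polyX_derivation mulr0 addr0 tau_polyMX.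
rewrite raddfB /= !map_polyM_derivation map_polyX_derivation mulr0 addr0.
rewrite -!mul_polyC map_polyM_derivation map_polyC /= map_poly_deriv_derivation IH.
rewrite !(derivE, derivM, derivX, derivC) /=.
set q := tau_poly t p; set r := tau_poly t _.
rewrite -!mul_polyC rmorphM.
have e2 : (2^-1)%:P * 2 = 1 :> P.
  by rewrite -(rmorph_nat polyC) -rmorphM mulVf ?(char0 1) ?rmorph1.
apply/eqP; rewrite -subr_eq0; apply/eqP.
transitivity (((2^-1)%:P * 2 - 1) * (d t)%:P * q^`()); first by ring.
by rewrite e2 subrr !mul0r.
Qed.

Lemma kder_tau t f : kder (tau t f) =
  tau t (kder f) - kconst (d t / 2) * dx (dx (tau t f)).
Proof.
apply: seriesP => n; rewrite coefsD coefsN kconstM_coef mul_polyC.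
exact: map_poly_tau_derivation.
Qed.

End Derivation.
End KMaps.

(** * The equations for psi *)

Section EvenSum.

(** [dsum F] is the sum over k of hbar^k F_k. *)
Definition dsum (F : nat -> S) : S :=
  Series (fun n => \sum_(k < n.+1 | (k.*2 <= n)%N) F k (n - k.*2)%N).

Lemma dsum_coef F n :
  dsum F n = \sum_(k < n.+1 | (k.*2 <= n)%N) F k (n - k.*2)%N.
Proof. by []. Qed.

Lemma dsumE F : dsum F = F 0%N + hvar * (hvar * dsum (fun k => F k.+1)).
Proof.
apply: seriesP => -[|[|n]]; rewrite coefsD ?hvarMS ?hvarM0 ?addr0 /=.
- by rewrite big_mkcond big_ord1.
- by rewrite big_mkcond !big_ord_recl big_ord0 /= !addr0.
rewrite big_mkcond big_ord_recl /= subn0; congr (_ + _).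
rewrite big_mkcond big_ord_recr /= ifF ?addr0; last first.
  by apply/negbTE; rewrite -ltnNge /bump /= doubleS; lia.
rewrite [RHS]big_mkcond /=; apply: eq_bigr => k _.
by rewrite /bump /= add1n doubleS !ltnS !subSS.
Qed.

Lemma eq_dsum F G : F =1 G -> dsum F = dsum G.
Proof. by move=> FG; apply: seriesP => n; apply: eq_bigr => k _; rewrite FG. Qed.

Lemma dsumD F G : dsum (fun k => F k + G k) = dsum F + dsum G.
Proof. by apply: seriesP => n; rewrite coefsD /= -big_split. Qed.

Lemma dsum0 F : (forall k, F k = 0) -> dsum F = 0.
Proof. by move=> F0; apply: seriesP => n; apply: big1 => k _; rewrite F0. Qed.

(** Each use of the hypothesis extracts a factor hbar, so H F is divisible by every power of
    hbar. *)
Lemma dsum_ext (H : (nat -> S) -> S) :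
    (forall F, H F = hvar * (hvar * H (fun k => F k.+1))) ->
  forall F, H F = 0.
Proof.
move=> HE F; apply: seriesP => n; move: F.
elim/ltn_ind: n => -[|[|n]] IH F; rewrite HE ?hvarMS ?hvarM0 //.
by rewrite IH.
Qed.

Lemma hlinear_dsum (H : S -> S) F : {morph H : f g / f + g} ->
  (forall f, H (hvar * f) = hvar * H f) -> H (dsum F) = dsum (fun k => H (F k)).
Proof.
move=> HD Hh; apply/eqP; rewrite -subr_eq0; apply/eqP; move: F.
by apply: dsum_ext => F; rewrite dsumE HD !Hh [X in _ - X]dsumE; ring.
Qed.

Lemma dsum_dsum (F : nat -> nat -> S) :
  dsum (fun k => dsum (F k)) = dsum (fun s => \sum_(k < s.+1) F k (s - k)%N).
Proof.
apply: seriesP => n; elim/ltn_ind: n F => n IH F.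
rewrite (dsumE (fun k => dsum (F k))) (dsumE (F 0%N)).
rewrite (dsumE (fun s => \sum_(k < s.+1) F k (s - k)%N)) big_ord1 subnn.
have -> : dsum (fun k => \sum_(i < k.+2) F i (k.+1 - i)%N) =
    dsum (fun k => F 0%N k.+1) + dsum (fun k => \sum_(i < k.+1) F i.+1 (k - i)%N).
  by rewrite -dsumD; apply: eq_dsum => k; rewrite big_ord_recl subn0.
rewrite !mulrDr -!addrA !coefsD; do 2 congr (_ + _).
case: n IH => [|[|n]] IH; rewrite ?hvarMS ?hvarM0 //.
by apply: (IH n) => //; lia.
Qed.

End EvenSum.

(** For t = z / (1 - z), this is (1 - z e^{x hbar^{1/2}}) / (1 - z). *)
Definition lambda (t : K) : S := 1 + kconst t - kconst t * gexp 1 0.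

Section Exponent.
Variable d : {additive K -> K}.
Hypothesis dM : forall a b, d (a * b) = d a * b + a * d b.

(** [L m] stands for Li_{2-m}(z); since Li_2 and Li_1 occur only in the terms
    that psi omits, they may be replaced by 0. *)
Variable L : nat -> K.
Hypotheses (L0 : L 0 = 0) (L1 : L 1 = 0).
Hypothesis dL : forall m, d (L m.+2) = L m.+3.
Local Notation t := (L 2).
Hypothesis L3 : L 3 = t * (1 + t).

(** [b k] stands for B_k / k!. *)
Variable b : nat -> K.
Hypotheses (b0 : b 0 = 1) (b1 : b 1 = - 2^-1).
(** In generating functions: B(u) e^u = B(u) + u, that is B(u) = u / (e^u - 1). *)
Hypothesis b_sum : forall s,
  \sum_(k < s.+1) b k / (s - k)`!%:R = b s + (s == 1)%:R.

Lemma d_nat n : d n%:R = 0.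
Proof. by rewrite raddfMn (derivation1 dM) mul0rn. Qed.

Lemma d_inv_nat n : d n%:R^-1 = 0.
Proof.
case: n => [|n]; first by rewrite invr0 raddf0.
have /eqP := dM n.+1%:R n.+1%:R^-1; rewrite mulfV ?char0 // (derivation1 dM).
by rewrite d_nat mul0r add0r eq_sym mulf_eq0 (negbTE (char0 n)) => /eqP.
Qed.

(** Up to the terms with Li_2 and Li_1, [polylog m] is
    Li_{2-m}(z e^{x hbar^{1/2}}). *)
Definition polylog m : S := Series (fun n => (L (m + n)%N / n`!%:R) *: 'X^n).

Lemma dx_polylog m : dx (polylog m) = hvar * polylog m.+1.
Proof.
apply: seriesP => -[|n]; rewrite ?hvarMS ?hvarM0 /=.
  by rewrite derivZ expr0 -(rmorph1 polyC) derivC scaler0.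
rewrite derivZ derivXn /= addnS -scaler_nat scalerA; congr (_ *: _).
rewrite factS natrM; field; by rewrite fact_neq0 -mulrS char0.
Qed.

Lemma theta_polylog m : theta (polylog m) = hvar * (xvar * polylog m.+1).
Proof.
apply: seriesP => -[|n]; rewrite ?hvarMS ?hvarM0 ?coefsCM //=.
rewrite scalerMnl -scalerAr -exprS addnS; congr (_ *: _).
rewrite -mulr_natr factS natrM; field; by rewrite fact_neq0 -mulrS char0.
Qed.

Lemma map_poly_scaleXn a n : map_poly d (a *: 'X^n) = d a *: 'X^n.
Proof.
apply/polyP => i; rewrite coef_map !coefZ coefXn.
by case: eqP; rewrite ?mulr1 ?mulr0 ?raddf0.
Qed.

Lemma d_coef m n : d (L (m + n)%N / n`!%:R) = d (L (m + n)%N) / n`!%:R.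
Proof. by rewrite dM d_inv_nat mulr0 addr0. Qed.

Lemma kder_polylog m : kder d (polylog m.+2) = polylog m.+3.
Proof.
by apply: seriesP => n; rewrite [LHS]map_poly_scaleXn d_coef !addSn dL.
Qed.

(** Taking [L 1 = 0] for Li_1 loses D Li_1 = t in the lowest coefficient, whence the correction; in
    [polylog 0] the same loss occurs in the coefficient of x h. *)
Lemma kder_polylog1 : kder d (polylog 1) = polylog 2 - kconst t.
Proof.
apply: seriesP => -[|n]; rewrite coefsD coefsN [LHS]map_poly_scaleXn d_coef /=.
  by rewrite addn0 L1 raddf0 mul0r scale0r divr1 alg_polyC subrr.
by rewrite subr0 !addSn add0n dL.
Qed.

Lemma kder_polylog0 : kder d (polylog 0) = polylog 1 - hvar * (kconst t * xvar).
Proof.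
apply: seriesP => -[|[|n]]; rewrite coefsD coefsN [LHS]map_poly_scaleXn d_coef.
- by rewrite hvarM0 /= !addn0 L0 L1 raddf0 !mul0r !scale0r subr0.
- rewrite hvarMS kconstM_coef /= add0n L1 raddf0 mul0r scale0r divr1 mul_polyC.
  by rewrite expr1 subrr.
by rewrite hvarMS kconstM_coef /= mulr0 subr0 add0n dL.
Qed.

(** Shifting x by h multiplies z e^{xh} by e^hbar, and e^{hbar D} expands as the sum of hbar^i D^i /
    i!, where D raises the index of [polylog] by one. *)
Lemma shift_polylog m :
  shift 1 (polylog m) = dsum (fun i => kconst i`!%:R^-1 * polylog (m + i)).
Proof.
apply: seriesP => n; rewrite shiftE (reindex_inj rev_ord_inj) dsum_coef.
rewrite [RHS]big_mkcond.
apply: eq_bigr => i _; rewrite [LHS]/=; have in_ : (i <= n)%N by rewrite -ltnS.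
rewrite subSS subKn // expr1n derivnZ derivnXn.
(* The derivative of order i of x^(n-i) vanishes when 2i > n, which is the range left out by
   [dsum]. *)
case: leqP => i2n; last first.
  by rewrite ffact_small ?mulr0n ?scaler0 //; rewrite -addnn in i2n; lia.
rewrite kconstM_coef /= mul_polyC.
rewrite -addnn subnDA -addnA subnKC; last by rewrite -addnn in i2n; lia.
have ini : (i <= n - i)%N by rewrite -addnn in i2n; lia.
rewrite -scaler_nat !scalerA; congr (_ *: _).
rewrite -(ffact_fact ini) natrM; field; rewrite !fact_neq0 /=.
have := fact_neq0 (n - i); rewrite -(ffact_fact ini) natrM mulf_eq0 negb_or.
by case/andP.
Qed.

(** hbar times the exponent of psi, up to the term with Li_0 at k = 0, l = 2. *)
Definition exponent0 : S := - dsum (fun k => kconst (b k) * polylog k).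

Lemma exponent0_coef n : exponent0 n = - \sum_(k < n.+1 | (k.*2 <= n)%N)
  (b k * (L (n - k)%N / (n - k.*2)`!%:R)) *: 'X^(n - k.*2).
Proof.
rewrite coefsN dsum_coef; congr (- _); apply: eq_bigr => k kn.
rewrite kconstM_coef /= mul_polyC scalerA; congr (_ * (L _ / _) *: _).
by rewrite -addnn in kn *; lia.
Qed.

(** Formally [exponent0] is -B(hbar D) applied to Li_2(z e^{xh}), and the shift is e^{hbar D}. As
    B(u) (e^u - 1) = u, the difference is -hbar D Li_2 = -hbar Li_1. *)
Lemma shift_exponent0 :
  shift 1 exponent0 = exponent0 - hvar * (hvar * polylog 1).
Proof.
rewrite raddfN /=
  (hlinear_dsum (H := shift 1) _ (raddfD (shift 1)) (@shift_hvar 1)).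
under eq_dsum => k.
  rewrite shift_kconstM shift_polylog.
  rewrite (hlinear_dsum (H := fun f => kconst (b k) * f)); first over.
    by move=> f g; rewrite mulrDr.
  by move=> f; rewrite mulrCA.
rewrite dsum_dsum.
under eq_dsum => s.
  under eq_bigr => k _ do rewrite subnKC ?(leq_ord k) // mulrA -rmorphM.
  rewrite -mulr_suml -rmorph_sum b_sum rmorphD mulrDl.
  over.
rewrite dsumD opprD; congr (_ - _).
rewrite dsumE dsumE dsum0 => [|k]; last by rewrite rmorph0 mul0r.
by rewrite rmorph0 rmorph1; ring.
Qed.

(** On a function of z e^{xh} the operators h D and d/dx agree. The remainder is the loss from the
    truncated Li_1 in the terms k = 0 and k = 1, weighted by [b 0] and [b 1]. *)
Lemma kder_exponent0 (bd : forall k, d (b k) = 0) :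
  hvar * kder d exponent0 =
    dx exponent0
    + hvar * (hvar * (kconst t * xvar - hvar * (kconst t * kconst 2^-1))).
Proof.
apply/eqP; rewrite addrC -subr_eq; apply/eqP.
rewrite !raddfN /= (hlinear_dsum (H := kder d) _ (raddfD (kder d)) (kder_hvar d)).
rewrite (hlinear_dsum (H := dx) _ (raddfD dx) dx_hvar).
rewrite mulrN opprK.
have -> : hvar * dsum (fun k => kder d (kconst (b k) * polylog k)) =
    dsum (fun k => dx (kconst (b k) * polylog k)) +
    dsum (fun k => hvar * (kconst (b k) * (kder d (polylog k) - polylog k.+1))).
  rewrite (hlinear_dsum (H := fun f => hvar * f)) //; last first.
    by move=> f g; rewrite mulrDr.
  rewrite -dsumD; apply: eq_dsum => k.
  rewrite (kderM dM) kder_kconst bd rmorph0 mul0r add0r dx_kconstM dx_polylog.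
  by ring.
rewrite opprD addrAC addNr add0r dsumE dsumE dsum0 => [|k /=]; last first.
  by rewrite kder_polylog subrr !mulr0.
rewrite kder_polylog0 kder_polylog1 b0 b1 rmorph1 rmorphN.
by ring.
Qed.

(** Of the pairs with k + l/2 <= 1, which psi omits, only k = 0, l = 2 survives in [exponent0], with
    value -t x^2 / 2; it is cancelled here. The others involve Li_2 or Li_1 and are already 0. *)
Definition psi_arg : S := Series (fun n =>
  exponent0 n.+2 + if n == 0 then (t / 2) *: 'X^2 else 0).

Lemma psi_argE : hvar * (hvar * psi_arg) =
  exponent0 + hvar * (hvar * (kconst (t / 2) * (xvar * xvar))).
Proof.
apply: seriesP => -[|[|n]]; rewrite coefsD ?hvarMS ?hvarM0 ?addr0.
- by rewrite exponent0_coef big_mkcond big_ord1 /= L0 mul0r mulr0 scale0r oppr0.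
- rewrite exponent0_coef big_mkcond !big_ord_recl big_ord0 /= L1.
  by rewrite mul0r mulr0 scale0r !addr0 oppr0.
rewrite -[LHS]/(exponent0 n.+2 + _); congr (_ + _).
rewrite kconstM_coef coefsCM /=.
by case: n => [|n] /=; rewrite ?mulr0 // mul_polyC expr2.
Qed.

Lemma psi_arg0 : psi_arg 0 = 0.
Proof.
rewrite -[LHS]/(exponent0 2 + (t / 2) *: 'X^2) exponent0_coef.
rewrite big_mkcond !big_ord_recl big_ord0 /= !subn0 L1 b0.
by rewrite mul0r mulr0 scale0r mul1r !addr0 addNr.
Qed.

Lemma kconst_half a : kconst (a / 2) = kconst a * kconst 2^-1.
Proof. exact: rmorphM. Qed.

(** The last summand is the increment t (x h + hbar/2) of the restored term t x^2 / 2. *)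
Lemma shift_psi_arg :
  shift 1 psi_arg = psi_arg + (- polylog 1 + gexp_arg t (t / 2)).
Proof.
apply/hvar_inj/hvar_inj; rewrite -!shift_hvar mulrDr [RHS]mulrDr !psi_argE.
rewrite raddfD /= shift_exponent0 !shift_hvar shift_kconstM shiftM shift_xvar rmorph1.
rewrite /gexp_arg kconst_half; have := kconst_inv2; set k2 := kconst 2^-1 => e.
apply/eqP; rewrite -subr_eq0; apply/eqP.
transitivity (hvar * (hvar * (hvar * (kconst t * xvar * (k2 * 2 - 1))))); first by ring.
by rewrite e subrr !mulr0.
Qed.

Lemma dx_psi_arg (bd : forall k, d (b k) = 0) :
  dx psi_arg = hvar * kder d psi_arg
    - hvar * (kconst (L 3 / 2) * (xvar * xvar) - kconst (t / 2)).
Proof.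
apply/hvar_inj/hvar_inj; rewrite -!dx_hvar.
transitivity (hvar * kder d (hvar * (hvar * psi_arg)) - hvar * (hvar * (hvar *
    (kconst (L 3 / 2) * (xvar * xvar) - kconst (t / 2))))); last first.
  by rewrite !kder_hvar; ring.
rewrite psi_argE !raddfD /= [hvar * (_ + _)]mulrDr (kder_exponent0 bd).
rewrite !kder_hvar !dx_hvar !(kderM dM) !dxM !kder_xvar // dx_xvar !kder_kconst dx_kconst.
rewrite dM d_inv_nat mulr0 addr0 dL !kconst_half.
have := kconst_inv2; set k2 := kconst 2^-1 => e.
apply/eqP; rewrite -subr_eq0; apply/eqP.
transitivity (hvar * (hvar * (kconst t * xvar * (k2 * 2 - 1)))); first by ring.
by rewrite e subrr !mulr0.
Qed.

(** This is Li_0(w) (1 - w) = w for w = z e^{xh}, divided by 1 - z. Functions of w satisfy theta f =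
    h x D f, and the factor 1/(1-z) changes D into D - t; both sides solve the resulting
    equation. *)
Lemma polylog2_lambda : polylog 2 * lambda t = kconst t * gexp 1 0.
Proof.
have kE : kder d (gexp 1 0) = 0.
  by rewrite (kder_gexp dM) (derivation1 dM) raddf0 raddf0; ring.
have tE : theta (gexp 1 0) = hvar * xvar * gexp 1 0.
  by rewrite theta_gexp rmorph1 rmorph0; ring.
pose F f : S := hvar * (xvar * (kder d f - kconst t * f)).
have k1 : kder d 1 = 0 by rewrite -(rmorph1 kconst) kder_kconst (derivation1 dM) raddf0.
apply: (theta_uniq poly_torsionfree (F := F)).
- apply/causal_hvar/causalM/causalD; first exact/causal_smap/causal_id.
  exact/causalN/causalM/causal_id.
- rewrite /F.
  have -> : theta (polylog 2 * lambda t) = theta (polylog 2) * lambda t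
      - polylog 2 * (kconst t * theta (gexp 1 0)).
    rewrite thetaM /lambda raddfB raddfD /= thetaM theta_const !theta_kconst.
    by ring.
  have -> : kder d (polylog 2 * lambda t) = kder d (polylog 2) * lambda t
      + polylog 2 * kconst (d t) * (1 - gexp 1 0).
    rewrite (kderM dM) /lambda raddfB raddfD /= (kderM dM) k1 !kder_kconst kE.
    by ring.
  rewrite theta_polylog kder_polylog tE dL L3 rmorphM rmorphD rmorph1 /lambda.
  by ring.
- rewrite thetaM /F (kderM dM) kE tE kder_kconst theta_kconst dL L3.
  by rewrite rmorphM rmorphD rmorph1; ring.
rewrite !coefsM0 coefsD coefsN coefsD kconstM_coef gexp0 /= divr1 addn0.
by rewrite alg_polyC !mulr1 addrK mulr1.
Qed.

(** With [L 1 = 0] the series [polylog 1] is Li_1(w) - Li_1(z) for w = z e^{xh}, and exp(-Li_1(w)) =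
    1 - w. *)
Lemma sexp_polylog : sexp (- polylog 1) = lambda t.
Proof.
symmetry; apply: (sexp_uniq poly_natU).
- by rewrite coefsN /= L1 mul0r scale0r oppr0.
- by rewrite coefsD coefsN coefsD kconstM_coef gexp0 /= mulr1 addrK.
rewrite raddfN /= theta_polylog mulNr -!mulrA polylog2_lambda /lambda.
rewrite raddfB raddfD /= theta_const theta_kconst thetaM theta_kconst theta_gexp.
by rewrite rmorph1 rmorph0; ring.
Qed.

Definition psi_series : S := sexp psi_arg.

Lemma psi_series0 : psi_series 0 = 1.
Proof. exact: sexp0. Qed.

Lemma shift_sexp c (f : S) : f 0 = 0 -> shift c (sexp f) = sexp (shift c f).
Proof.
move=> f0; apply: (sexp_uniq poly_natU).
- by rewrite shift_coef0.
- by rewrite shift_coef0 sexp0.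
have tf : theta (sexp f) = theta f * sexp f by apply: (theta_sexp poly_natU).
have df : dx (sexp f) = dx f * sexp f.
  by apply: (derivation_sexp poly_natU) => //; exact: derivM.
by rewrite !theta_shift !dx_shift tf df !shiftM; ring.
Qed.

Lemma shift_psi_series :
  shift 1 psi_series = lambda t * gexp t (t / 2) * psi_series.
Proof.
have p0 : (- polylog 1) 0 = 0 by rewrite coefsN /= L1 mul0r scale0r oppr0.
rewrite shift_sexp ?psi_arg0 // shift_psi_arg.
rewrite !(sexpD poly_natU) ?coefsD ?psi_arg0 ?gexp_arg0 ?p0 ?addr0 //.
by rewrite sexp_polylog mulrC.
Qed.

Lemma dx_psi_series (bd : forall k, d (b k) = 0) :
  dx psi_series = hvar * kder d psi_series
    - hvar * (kconst (L 3 / 2) * (xvar * xvar) - kconst (t / 2)) * psi_series.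
Proof.
have -> : dx psi_series = dx psi_arg * psi_series.
  by apply: (derivation_sexp poly_natU); [exact: derivM | exact: psi_arg0].
have -> : kder d psi_series = kder d psi_arg * psi_series.
  apply: (derivation_sexp poly_natU); last exact: psi_arg0.
  exact: map_polyM_derivation.
by rewrite (dx_psi_arg bd); ring.
Qed.

End Exponent.

(** * The equations for the Gaussian average *)

Section Fourier.
Variable d : {additive K -> K}.
Hypothesis dM : forall a b, d (a * b) = d a * b + a * d b.
Variable phi : {rmorphism K -> K}.
Variable t : K.
Hypotheses (t0 : t != 0) (dt : d t = (1 + t) * t).
(** [phi] stands for the substitution of 1/(1-z): Li_0(1/(1-z)) = -1/z = -1 - 1/t, and the factor t
    in [d_phi] comes from D (1/(1-z)) = t/(1-z). *)
Hypothesis phit : phi t = - 1 - t^-1.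
Hypothesis d_phi : forall a, d (phi a) = t * phi (d a).
Variable psi : S.
Hypothesis shift_psi : shift 1 psi = lambda t * gexp t (t / 2) * psi.
Hypothesis dx_psi : dx psi = hvar * kder d psi
    - hvar * (kconst (d t / 2) * (xvar * xvar) - kconst (t / 2)) * psi.

Definition fourier : S :=
  gexp 0 (- 24^-1) * scale t (tau t (gexp 2^-1 0 * kmap phi psi)).

Let two_neq0 : (2 : K) != 0. Proof. exact: (char0 1). Qed.

(** The Gaussian operator trades a factor e^{a x h} for a shift by -a t. The equation with one shift
    and two exponentials thus becomes a relation between two shifts, from which the shift by t can
    be isolated; rescaling x by t makes it a shift by 1. *)
Lemma shift_fourier :
  shift 1 fourier = lambda t * gexp t (t / 2) * fourier.
Proof.
(* Here [lambda (phi t)] is -1/t + (1 + 1/t) e^{xh}. Shifting e^{xh/2} contributes e^{hbar/2}, which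
   changes the exponent (phi t)/2 of e^hbar into -1/(2t). *)
have shf : shift 1 (gexp 2^-1 0 * kmap phi psi) =
    - kconst t^-1 *
      (gexp (- 1 - t^-1) (- (2 * t)^-1) * (gexp 2^-1 0 * kmap phi psi))
    + kconst (1 + t^-1) *
      (gexp (- t^-1) (- (2 * t)^-1) * (gexp 2^-1 0 * kmap phi psi)).
  rewrite shiftM shift_gexp shift1_kmap shift_psi /lambda !kmapM raddfB raddfD /= kmapM.
  rewrite !kmap_kconst !kmap_gexp !(rmorph1, rmorph0) (fmorph_div phi) rmorph_nat phit.
  have -> : gexp 2^-1 (0 + 2^-1 * 1) = gexp 2^-1 0 * gexp 0 2^-1.
    by rewrite gexpD; apply: eq_gexp; field.
  have -> : gexp (- t^-1) (- (2 * t)^-1) =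
      gexp 0 2^-1 * gexp (- 1 - t^-1) ((- 1 - t^-1) / 2) * gexp 1 0.
    by rewrite !gexpD; apply: eq_gexp; field; rewrite ?t0 ?two_neq0.
  have -> : gexp (- 1 - t^-1) (- (2 * t)^-1) =
      gexp 0 2^-1 * gexp (- 1 - t^-1) ((- 1 - t^-1) / 2).
    by rewrite !gexpD; apply: eq_gexp; field; rewrite ?t0 ?two_neq0.
  rewrite !(rmorphB, rmorphD, rmorphN, rmorph1) /=; ring.
rewrite /fourier; move: (_ * kmap phi psi) shf => f shf.
pose g := tau t f; pose A := - 1 - t^-1; pose B := - (2 * t)^-1.
(* Under [tau] the exponents A and -1/t become shifts by -A t = 1 + t and by 1, so both terms other
   than the first carry the same shift of g. *)
have shg : gexp A (B - A ^+ 2 * t / 2) * shift (1 + t) g =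
    (kconst (1 + t) * gexp (- t^-1) (- t^-1) - kconst t) * shift 1 g.
  have e : kconst t * kconst t^-1 = 1 by rewrite -rmorphM mulfV ?rmorph1.
  have := congr1 (tau t) shf.
  rewrite shift_tau raddfD /= mulNr raddfN /= !tau_kconstM !tau_gexp -/g.
  have -> : - ((- 1 - t^-1) * t) = 1 + t by field.
  have -> : - (- t^-1 * t) = 1 by field.
  have -> : - (2 * t)^-1 - (- t^-1) ^+ 2 * t / 2 = - t^-1 :> K.
    by field; rewrite two_neq0 t0.
  rewrite -/A -/B; set X := gexp A _ * _; set Y := gexp _ _ => E1.
  have -> : X = kconst t * kconst t^-1 * X by rewrite e mul1r.
  apply/eqP; rewrite -subr_eq0; apply/eqP.
  transitivity (kconst t *
       (shift 1 g - (- (kconst t^-1 * X) + kconst (1 + t^-1) * (Y * shift 1 g)))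
     + (kconst t * kconst (1 + t^-1) - kconst (1 + t)) * Y * shift 1 g); first by ring.
  rewrite -E1 subrr mulr0 add0r -rmorphM -rmorphB.
  have -> : t * (1 + t^-1) - (1 + t) = 0 by field.
  by rewrite rmorph0 !mul0r.
(* A shift by -1 leaves g unshifted on the right; the multiplier exp((1 + 1/t) x h + t hbar/2) is
   the inverse of the shifted factor on the left. *)
have sht : shift t g =
    (kconst (1 + t) * gexp 1 (t / 2) - kconst t * gexp (1 + t^-1) (t / 2)) * g.
  have := congr1 (fun f => gexp (1 + t^-1) (t / 2) * shift (- 1) f) shg.
  rewrite !shiftM raddfB /= shift_kconstM shift_kconst !shift_gexp !shift_shift.
  have -> : - 1 + (1 + t) = t by ring.
  rewrite addNr shift0 [LHS]mulrA gexpD.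
  have -> : 1 + t^-1 + A = 0 by rewrite /A; ring.
  have -> : t / 2 + (B - A ^+ 2 * t / 2 + A * -1) = 0.
    by rewrite /A /B; field; rewrite two_neq0 t0.
  rewrite gexp00 mul1r => ->.
  have -> : gexp 1 (t / 2) =
      gexp (1 + t^-1) (t / 2) * gexp (- t^-1) (- t^-1 + - t^-1 * -1).
    by rewrite gexpD; apply: eq_gexp; ring.
  by ring.
rewrite -/g shiftM -scale_shift mulr1 sht scaleM raddfB /= !scaleM.
rewrite !scale_kconst !scale_gexp shift_gexp /lambda.
have -> : 1 * t = t by ring.
have -> : (1 + t^-1) * t = 1 + t by field.
have -> : gexp (1 + t) (t / 2) = gexp 1 0 * gexp t (t / 2).
  by rewrite gexpD add0r.
by rewrite mul0r addr0 rmorphD rmorph1; ring.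
Qed.

Lemma dx_fourier :
  dx fourier = hvar * kder d fourier
    - hvar * (kconst (d t / 2) * (xvar * xvar) - kconst (t / 2)) * fourier.
Proof.
pose f := gexp 2^-1 0 * kmap phi psi; pose g := tau t f.
have e2 := kconst_inv2; have e : kconst t * kconst t^-1 = 1.
  by rewrite -rmorphM mulfV ?rmorph1.
have kmap_kder u : kder d (kmap phi u) = kconst t * kmap phi (kder d u).
  apply: seriesP => n; rewrite kconstM_coef mul_polyC.
  by apply/polyP => i; rewrite coefZ !coef_map d_phi.
have kder_exp a b : d a = 0 -> d b = 0 -> kder d (gexp a b) = 0.
  by move=> a0 b0; rewrite (kder_gexp dM) a0 b0 rmorph0; ring.
have kf : kder d f = kconst t * (gexp 2^-1 0 * kmap phi (kder d psi)).
  by rewrite /f (kderM dM) kder_exp ?(d_inv_nat dM) ?raddf0 // kmap_kder; ring.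
(* The factor t^2 clears the denominators: phi (d t / 2) = (1 + t)/(2 t^2) and phi (t/2) = -(1 +
   t)/(2t). *)
have df : kconst t * kconst t * dx f =
    hvar * (kconst (t ^+ 2 / 2) * f + kconst t * kder d f
      - kconst ((1 + t) / 2) * (xvar * (xvar * f) + kconst t * f)).
  have km : kmap phi (dx psi) = hvar * kmap phi (kder d psi)
      - hvar * (kconst (phi (d t / 2)) * (xvar * xvar) - kconst (phi (t / 2)))
        * kmap phi psi.
    rewrite dx_psi raddfB /= !(kmapM, kmap_hvar) raddfB /= !kmapM.
    by rewrite !kmap_kconst kmap_xvar kmap_var.
  rewrite kf /f dxM dx_gexp dx_kmap km.
  have -> : kconst ((1 + t) / 2) = kconst t * kconst t * kconst (phi (d t / 2)).
    rewrite -!rmorphM dt (fmorph_div phi) (rmorph_nat phi) (rmorphM phi).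
    rewrite (rmorphD phi) (rmorph1 phi) phit.
    by congr (kconst _); field; rewrite t0 two_neq0.
  have -> : kconst (phi (t / 2)) = - (kconst t * kconst (phi (d t / 2))).
    rewrite -rmorphM -rmorphN dt !(fmorph_div phi) !(rmorph_nat phi).
    rewrite (rmorphM phi) (rmorphD phi) (rmorph1 phi) phit.
    by congr (kconst _); field; rewrite t0 two_neq0.
  by rewrite expr2 !rmorphM; ring.
have e2c : kconst (1 + t) = kconst ((1 + t) / 2) * 2.
  by rewrite -(rmorph_nat kconst 2) -rmorphM; congr (kconst _); field; rewrite two_neq0.
(* Replacing x by x - t d/dx in x^2 creates a second derivative, which cancels against the one from
   differentiating [tau] because d t = (1 + t) t; the terms without x cancel likewise, except
   t^2/2. *)
have dg : kconst t * kconst t * dx g =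
    hvar * (kconst (t ^+ 2 / 2) * g + kconst t * kder d g
      - kconst ((1 + t) / 2) * (xvar * (xvar * g))
      + kconst (1 + t) * kconst t * xvar * dx g).
  have := congr1 (tau t) df.
  rewrite -rmorphM tau_kconstM tau_hvar !(tauB, tauD, tau_kconstM) !tau_xvar.
  rewrite -!dx_tau -/g.
  have -> : tau t (kder d f) = kder d g + kconst (d t / 2) * dx (dx g).
    by rewrite (kder_tau dM) subrK.
  have -> : d t / 2 = (1 + t) / 2 * t by rewrite dt; ring.
  rewrite dxB dxM dx_xvar dx_kconstM e2c !(rmorphM kconst _ t) => ->.
  by ring.
pose r := scale t g.
have dr : dx r = hvar * kder d r
    - hvar * (kconst (d t / 2) * (xvar * xvar) - kconst (t / 2)) * r.
  (* The derivative of the scaling factor t absorbs the remaining first-order term in x d/dx. *)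
  have kr : kder d r = scale t (kder d g) + kconst (1 + t) * xvar * dx r.
    by rewrite (kder_scale dM _ dt).
  have := congr1 (scale t) dg.
  rewrite !(scaleM, scaleB, scaleD) scale_var !scale_kconst scale_xvar.
  rewrite -/r => E1.
  have E2 : kconst t * dx r = hvar * kconst t * (kder d r
    - (kconst (d t / 2) * (xvar * xvar) - kconst (t / 2)) * r).
    have -> : kconst t * dx r = kconst t * kconst t * scale t (dx g).
      by rewrite dx_scale mulrA.
    have -> : d t / 2 = (1 + t) / 2 * t by rewrite dt; ring.
    rewrite E1 kr /r dx_scale -/r.
    have -> : t ^+ 2 / 2 = t * (t / 2) by ring.
    by rewrite e2c (rmorphM kconst t (t / 2)) (rmorphM kconst _ t); ring.
  have := congr1 (fun u => kconst t^-1 * u) E2.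
  rewrite !mulrA [kconst t^-1 * _]mulrC e mul1r => ->.
  rewrite [_ * hvar]mulrC -!mulrA [kconst t^-1 * _]mulrA [kconst t^-1 * _]mulrC e mul1r.
  by ring.
have kG : kder d (gexp 0 (- 24^-1)) = 0.
  by rewrite kder_exp ?raddf0 // raddfN /= (d_inv_nat dM) oppr0.
rewrite /fourier -/f -/g -/r dxM (kderM dM) kG dx_gexp rmorph0 dr.
by ring.
Qed.

End Fourier.

(** * Uniqueness for the two equations *)

Section Uniqueness.
Variable d : {additive K -> K}.
Hypothesis dM : forall a b, d (a * b) = d a * b + a * d b.
Variable t : K.
Hypothesis dt : d t = (1 + t) * t.
(** The normalization is kept abstract: any condition that only 0 satisfies among the constants of
    [d] will do. It is later taken to be vanishing at z = oo. *)
Variable N : K -> Prop.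
Hypothesis N_const : forall a, N a -> d a = 0 -> a = 0.

Lemma deriv_eq0 (p : P) : p^`() = 0 -> p = (p`_0)%:P.
Proof.
move=> p0; apply/polyP => -[|n]; rewrite coefC //=.
have /eqP := congr1 (fun q : P => q`_n) p0; rewrite coef_deriv coef0.
by rewrite -mulr_natr mulf_eq0 (negbTE (char0 n)) orbF => /eqP.
Qed.

Lemma gexp_coef1 a b : gexp a b 1 = a *: 'X.
Proof.
have := congr1 (fun f : S => f 1) (theta_gexp a b).
rewrite thetaE mulr1n -mulrA hvarMS coefsM0 gexp0 mulr1 !coefsD !kconstM_coef.
by rewrite -[hvar 0]/0 !mulr0 !addr0 mul_polyC.
Qed.

Lemma gexp_coef2 a b : gexp a b 2 *+ 2 = a ^+ 2 *: 'X^2 + (b *+ 2)%:P.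
Proof.
have := congr1 (fun f : S => f 2) (theta_gexp a b).
rewrite thetaE -mulrA hvarMS coefsM1 !coefsD !kconstM_coef gexp0 gexp_coef1.
rewrite -[hvar 0]/0 -[hvar 1]/1 -[xvar 0]/'X -[xvar 1]/0 => ->.
by rewrite -!mul_polyC rmorphMn rmorphXn /=; ring.
Qed.

Lemma shift_coef1 (f : S) : shift 1 f 1 = f 1 + (f 0)^`().
Proof.
rewrite shiftE 2!big_ord_recl big_ord0 addr0 subn0 addrC shift_poly0E.
by rewrite /= expr1 divr1 scale1r.
Qed.

Lemma shift_coef2 (f : S) : (f 0)^`() = 0 -> shift 1 f 2 = f 2 + (f 1)^`().
Proof.
move=> f0; rewrite shiftE 3!big_ord_recl big_ord0 addr0 shift_poly0E.
rewrite -[shift_poly _ _ _]/(_ *: _^`(2)) derivSn f0 linear0 scaler0 add0r.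
by rewrite addrC /= expr1 divr1 scale1r.
Qed.

Definition dilog_eqs (f : S) :=
  shift 1 f = lambda t * gexp t (t / 2) * f /\
  dx f = hvar * kder d f
    - hvar * (kconst (d t / 2) * (xvar * xvar) - kconst (t / 2)) * f.

Lemma dilog_eqs_tail f : dilog_eqs (hvar * f) -> dilog_eqs f.
Proof.
case=> s x; split; apply: hvar_inj; first by rewrite -shift_hvar s; ring.
by rewrite -dx_hvar x kder_hvar; ring.
Qed.

(** The shift equation gives f_0' = 0 in degree 1, because its factor A has A_1 = 0, and f_1' = A_2
    f_0 in degree 2. The differential equation gives f_1' = D f_0 + A_2 f_0 in degree 1, so D f_0 =
    0. *)
Lemma dilog_eqs_coef0 f : dilog_eqs f -> (forall i, N (f 0)`_i) -> f 0 = 0.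
Proof.
case=> s x Nf; pose A := lambda t * gexp t (t / 2).
have l0 : lambda t 0 = 1.
  by rewrite !coefsD coefsN kconstM_coef gexp0 /= mulr1 addrK.
have l1 : lambda t 1 = - (t *: 'X).
  by rewrite !coefsD coefsN kconstM_coef gexp_coef1 /= scale1r mul_polyC !add0r.
have l2 : lambda t 2 *+ 2 = - (t *: 'X^2).
  rewrite !coefsD coefsN kconstM_coef /= !add0r mulNrn -mulrnAr gexp_coef2.
  by rewrite expr1n scale1r mul0rn addr0 mul_polyC.
have A0 : A 0 = 1 by rewrite coefsM0 l0 gexp0 mulr1.
have A1 : A 1 = 0.
  by rewrite coefsM1 gexp0 gexp_coef1 l0 l1 mul1r mulr1 subrr.
have A2 : A 2 = - ((d t / 2) *: 'X^2) + (t / 2)%:P.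
  apply/eqP; rewrite -subr_eq0; apply/eqP/(@poly_torsionfree 1).
  rewrite mulrnBl coefsM2 gexp0 l0 mul1r !mulr1 l1 gexp_coef1.
  move: (lambda t 2) l2 => u l2; rewrite !mulrnDl gexp_coef2 l2 dt.
  have e2 (a : K) : (a / 2) *+ 2 = a by rewrite -[LHS]mulr_natr divfK ?(char0 1).
  rewrite mulNrn -(rmorphMn polyC) /= [_ *: _ *+ 2]scalerMnl !e2 -!mul_polyC.
  by rewrite expr2 !polyCM polyCD polyC1; ring.
have f0 : (f 0)^`() = 0.
  have := congr1 (fun u : S => u 1) s; rewrite -/A shift_coef1.
  by rewrite coefsM1 A0 A1 mul1r mul0r addr0 -[RHS]addr0 => /addrI.
have f1 : (f 1)^`() = A 2 * f 0.
  have := congr1 (fun u : S => u 2) s; rewrite -/A shift_coef2 //.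
  by rewrite coefsM2 A0 A1 mul1r mul0r addr0 => /addrI.
have kf0 : map_poly d (f 0) = 0.
  have := congr1 (fun u : S => u 1) x; rewrite -[LHS]/((f 1)^`()) f1 A2.
  rewrite coefsD coefsN -mulrA !hvarMS coefsM0 coefsD coefsN kconstM_coef coefsCM /=.
  rewrite -expr2 mul_polyC => /eqP; rewrite -subr_eq0 => /eqP e.
  rewrite -[LHS]opprK -[RHS]oppr0 -[in RHS]e; congr (- _); ring.
move: kf0; rewrite (deriv_eq0 f0) map_polyC /= => /eqP.
by rewrite polyC_eq0 => /eqP /(N_const (Nf 0%N)) ->; rewrite raddf0.
Qed.

Lemma dilog_eqs_eq0 f : dilog_eqs f -> (forall n i, N (f n)`_i) -> f = 0.
Proof.
move=> ef Nf; apply: seriesP => n; elim: n f ef Nf => [|n IH] f ef Nf.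
  by rewrite (dilog_eqs_coef0 ef).
have e := series_eta f; rewrite (dilog_eqs_coef0 ef) // raddf0 add0r in e.
rewrite e hvarMS IH // => [|k i]; last exact: Nf.
by apply: dilog_eqs_tail; rewrite -e.
Qed.

Lemma dilog_eqsB f g : dilog_eqs f -> dilog_eqs g -> dilog_eqs (f - g).
Proof.
case=> sf xf [sg xg]; split; first by rewrite raddfB /= sf sg; ring.
by rewrite dxB xf xg raddfB /=; ring.
Qed.

End Uniqueness.

End Operators.

(** * The field Q(z) *)

(* Stated over an abstract field because [field] does not terminate on [Qz]. *)
Lemma quotient_ruleB (F : fieldType) (a a' b b' u u' v v' : F) :
  b != 0 -> v != 0 ->
  ((a' * v + a * v' - (u' * b + u * b')) * (b * v)
    - (a * v - u * b) * (b' * v + b * v')) / (b * v * (b * v)) =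
  (a' * b - a * b') / (b * b) - (u' * v - u * v') / (v * v).
Proof. by move=> b0 v0; field; rewrite b0 v0. Qed.

Lemma quotient_ruleM (F : fieldType) (a a' b b' u u' v v' : F) :
  b != 0 -> v != 0 ->
  ((a' * u + a * u') * (b * v) - a * u * (b' * v + b * v')) / (b * v * (b * v)) =
  (a' * b - a * b') / (b * b) * (u / v) + a / b * ((u' * v - u * v') / (v * v)).
Proof. by move=> b0 v0; field; rewrite b0 v0. Qed.

Lemma quotient_rule_chain (F : fieldType) (a a' b b' e : F) : b != 0 ->
  e * a' = e * ((a' * b - a * b') / (b * b)) * b + a / b * (e * b').
Proof. by move=> b0; field. Qed.

Lemma frac_repr (f : Qz) : f * tofrac \d_(repr f) = tofrac \n_(repr f).
Proof.
rewrite -{1}[f]reprK; unlock tofrac; rewrite -[LHS]FracField.pi_mul.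
apply/eqmodP; rewrite /= FracField.equivfE /FracField.mulf /=.
by rewrite !numden_Ratio ?(oner_neq0, mulr1, mulf_neq0, denom_ratioP) // mulrC.
Qed.

Lemma fracP (f : Qz) : exists n d : {poly rat},
  [/\ d != 0, f = tofrac n / tofrac d, n = \n_(repr f) & d = \d_(repr f)].
Proof.
exists \n_(repr f), \d_(repr f); split=> //; first exact: denom_ratioP.
by rewrite -frac_repr mulfK // tofrac_eq0 denom_ratioP.
Qed.

Lemma eq_frac (n d n' d' : {poly rat}) : d != 0 -> d' != 0 ->
  tofrac n / tofrac d = tofrac n' / tofrac d' -> n * d' = n' * d.
Proof.
move=> d0 d'0 /eqP; rewrite eqr_div ?tofrac_eq0 // -!tofracM tofrac_eq.
by move=> /eqP.
Qed.

(** [ddz] is defined on a chosen representative; the relation n d' = n' d between two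
    representatives and its derivative show that the choice does not matter. *)
Lemma ddz_frac (n d : {poly rat}) : d != 0 ->
  ddz (tofrac n / tofrac d) = tofrac (n^`() * d - n * d^`()) / tofrac (d ^+ 2).
Proof.
move=> d0; have [n' [d' [d'0 e en ed]]] := fracP (tofrac n / tofrac d).
rewrite /ddz -en -ed; apply/eqP; rewrite eqr_div ?tofrac_eq0 ?expf_neq0 //.
rewrite -!tofracM tofrac_eq; have {}e := eq_frac d0 d'0 e.
have := congr1 (@deriv _) e; rewrite !derivM => e'.
apply/eqP; apply/eqP; rewrite -subr_eq0; apply/eqP.
transitivity (- d * d' * (n^`() * d' + n * d'^`() - (n'^`() * d + n' * d^`()))
   + (d * d'^`() + d' * d^`()) * (n * d' - n' * d)); first by ring.
by rewrite e e' !subrr !mulr0 addr0.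
Qed.

Fact ddz_is_zmod_morphism : zmod_morphism ddz.
Proof.
move=> f g; have [n [d [d0 -> _ _]]] := fracP f.
have [n' [d' [d'0 -> _ _]]] := fracP g.
have e : tofrac n / tofrac d - tofrac n' / tofrac d' =
    tofrac (n * d' - n' * d) / tofrac (d * d').
  by rewrite -mulNr addf_div ?tofrac_eq0 // -tofracN -!tofracM -tofracD mulNr.
rewrite e !ddz_frac ?mulf_neq0 // derivB !derivM.
rewrite !(tofracM, tofracD, tofracN, tofracXn).
by apply: quotient_ruleB; rewrite tofrac_eq0.
Qed.
HB.instance Definition _ := GRing.isZmodMorphism.Build Qz Qz ddz
  ddz_is_zmod_morphism.

Lemma ddzM f g : ddz (f * g) = ddz f * g + f * ddz g.
Proof.
have [n [d [d0 -> _ _]]] := fracP f; have [n' [d' [d'0 -> _ _]]] := fracP g.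
rewrite mulf_div -!tofracM !ddz_frac ?mulf_neq0 // !derivM.
rewrite !(tofracM, tofracD, tofracN, tofracXn).
by apply: quotient_ruleM; rewrite tofrac_eq0.
Qed.

Lemma ddz_tofrac p : ddz (tofrac p) = tofrac p^`().
Proof.
rewrite -[tofrac p]divr1 -tofrac1 ddz_frac ?oner_neq0 //.
by rewrite expr1n tofrac1 divr1 -(rmorph1 polyC) derivC mulr0 subr0 mulr1.
Qed.

Lemma ddz_ratQz a : ddz (ratQz a) = 0.
Proof. by rewrite [LHS]ddz_tofrac derivC tofrac0. Qed.

Lemma ddz_z : ddz z = 1.
Proof. by rewrite ddz_tofrac derivX tofrac1. Qed.

Lemma rat_char0 n : n.+1%:R != 0 :> rat.
Proof. by rewrite Num.Theory.pnatr_eq0. Qed.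

Lemma Qz_char0 n : n.+1%:R != 0 :> Qz.
Proof. by rewrite -(rmorph_nat ratQz) fmorph_eq0 rat_char0. Qed.

(** In lowest terms n/d, the vanishing numerator shows that d divides n times the derivative of d,
    hence that derivative, which has lower degree. So d is constant, and then n is. *)
Lemma ddz_eq0 f : ddz f = 0 -> exists a, f = ratQz a.
Proof.
have [n [d [d0 -> _ _]]] := fracP f.
have g0 : gcdp n d != 0 by rewrite gcdp_eq0 (negbTE d0) andbF.
have en := divpK (dvdp_gcdl n d); have ed := divpK (dvdp_gcdr n d).
have cop : coprimep (d %/ gcdp n d) (n %/ gcdp n d).
  by rewrite coprimep_sym coprimep_div_gcd // d0 orbT.
have d10 : d %/ gcdp n d != 0.
  by apply: contraNneq d0 => e; rewrite -ed e mul0r.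
have -> : tofrac n / tofrac d = tofrac (n %/ gcdp n d) / tofrac (d %/ gcdp n d).
  rewrite -{1}ed -{1}en !tofracM -mulf_div divff ?tofrac_eq0 // mulr1.
  by [].
move: (n %/ _) (d %/ _) cop d10 => n1 d1 cop d10.
rewrite ddz_frac // => /eqP; rewrite mulf_eq0 invr_eq0 !tofrac_eq0.
rewrite (negbTE (expf_neq0 2 d10)) orbF subr_eq0 => /eqP e.
have d1' : d1^`() = 0.
  apply/eqP; apply: contraTT cop => d1'0.
  have : d1 %| n1 * d1^`() by rewrite -e dvdp_mull.
  move=> dv; apply/negP => cop; move: dv; rewrite Gauss_dvdpr // => /dvdp_leq.
  by rewrite d1'0 => /(_ isT); rewrite leqNgt lt_size_deriv.
move: e; rewrite d1' mulr0 => /eqP; rewrite mulf_eq0 (negbTE d10) orbF => /eqP n1'.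
rewrite (deriv_eq0 rat_char0 d1') (deriv_eq0 rat_char0 n1').
by exists (n1`_0 / d1`_0); rewrite fmorph_div.
Qed.

(** * Substitution in rational functions *)

Definition peval (s : Qz) (p : {poly rat}) : Qz := (map_poly ratQz p).[s].

Fact peval_is_zmod_morphism s : zmod_morphism (peval s).
Proof. by move=> p q; rewrite /peval rmorphB hornerD hornerN. Qed.
HB.instance Definition _ s := GRing.isZmodMorphism.Build {poly rat} Qz (peval s)
  (peval_is_zmod_morphism s).
Fact peval_is_monoid_morphism s : monoid_morphism (peval s).
Proof.
by split=> [|p q]; rewrite /peval ?rmorph1 ?hornerC // rmorphM hornerM.
Qed.
HB.instance Definition _ s := GRing.isMonoidMorphism.Build {poly rat} Qz (peval s)
  (peval_is_monoid_morphism s).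

Lemma pevalD s p q : peval s (p + q) = peval s p + peval s q.
Proof. exact: rmorphD. Qed.
Lemma pevalM s p q : peval s (p * q) = peval s p * peval s q.
Proof. exact: rmorphM. Qed.
Lemma pevalC s a : peval s a%:P = ratQz a.
Proof. by rewrite /peval map_polyC hornerC. Qed.
Lemma pevalX s : peval s 'X = s.
Proof. by rewrite /peval map_polyX hornerX. Qed.
Lemma ddz_peval s p : ddz (peval s p) = ddz s * peval s p^`().
Proof.
elim/poly_ind: p => [|p c IH]; first by rewrite deriv0 !raddf0 mulr0.
rewrite derivMXaddC !(rmorphD, rmorphM) /= pevalX pevalC raddfD /= ddzM IH ddz_ratQz.
by ring.
Qed.

(** Such an s is transcendental over Q: differentiating a relation p(s) = 0 gives one of lower
    degree, down to a nonzero constant. Hence denominators survive the substitution of s. *)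
Lemma peval_neq0 s p : ddz s != 0 -> p != 0 -> peval s p != 0.
Proof.
move=> s0; elim/ltn_ind: {p}(size p) {-2}p (erefl (size p)) => n IH p sp p0.
apply/eqP => e; have := ddz_peval s p; rewrite e raddf0 => /esym/eqP.
rewrite mulf_eq0 (negbTE s0) /= => e'.
have [p'0|p'0] := eqVneq p^`() 0.
  move: e p0; rewrite (deriv_eq0 rat_char0 p'0) pevalC => /eqP.
  by rewrite fmorph_eq0 polyC_eq0 => ->.
by move: e'; rewrite (negbTE (IH _ _ _ erefl p'0)) // -sp lt_size_deriv.
Qed.

Section Substitution.
Variable s : Qz.
Hypothesis s0 : ddz s != 0.

Lemma zsubst_frac n d : d != 0 ->
  zsubst s (tofrac n / tofrac d) = peval s n / peval s d.
Proof.
move=> d0; have [n' [d' [d'0 e en ed]]] := fracP (tofrac n / tofrac d).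
rewrite /zsubst -en -ed -!/(peval _ _); apply/eqP.
by rewrite eqr_div ?peval_neq0 // -!rmorphM /= (eq_frac d0 d'0 e).
Qed.

Lemma zsubst_tofrac p : zsubst s (tofrac p) = peval s p.
Proof.
by rewrite -[tofrac p]divr1 -tofrac1 zsubst_frac ?oner_neq0 // rmorph1 divr1.
Qed.

Lemma zsubstB : zmod_morphism (zsubst s).
Proof.
move=> f g; have [n [d [d0 -> _ _]]] := fracP f.
have [n' [d' [d'0 -> _ _]]] := fracP g.
have -> : tofrac n / tofrac d - tofrac n' / tofrac d' =
    tofrac (n * d' - n' * d) / tofrac (d * d').
  by rewrite -mulNr addf_div ?tofrac_eq0 // -tofracN -!tofracM -tofracD mulNr.
rewrite !zsubst_frac ?mulf_neq0 // rmorphB !rmorphM /=.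
by rewrite -[X in _ = _ + X]mulNr addf_div ?peval_neq0 // mulNr.
Qed.

Lemma zsubstM : monoid_morphism (zsubst s).
Proof.
split=> [|f g]; first by rewrite -tofrac1 zsubst_tofrac rmorph1.
have [n [d [d0 -> _ _]]] := fracP f; have [n' [d' [d'0 -> _ _]]] := fracP g.
by rewrite mulf_div -!tofracM !zsubst_frac ?mulf_neq0 // !rmorphM /= mulf_div.
Qed.

Lemma zsubst_z : zsubst s z = s.
Proof. by rewrite zsubst_tofrac pevalX. Qed.

Lemma zsubst_ratQz a : zsubst s (ratQz a) = ratQz a.
Proof. by rewrite [LHS]zsubst_tofrac pevalC. Qed.

Lemma ddz_zsubst f : ddz (zsubst s f) = ddz s * zsubst s (ddz f).
Proof.
have [n [d [d0 -> _ _]]] := fracP f.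
rewrite ddz_frac // !zsubst_frac ?expf_neq0 //.
have pd0 := peval_neq0 s0 d0.
have e : peval s n = peval s n / peval s d * peval s d by rewrite divfK.
have := congr1 ddz e; rewrite ddzM !ddz_peval => e'.
apply: (mulIf pd0); apply: (addIr (peval s n / peval s d * (ddz s * peval s d^`()))).
rewrite -e' rmorphB !rmorphM /=; exact: quotient_rule_chain.
Qed.

End Substitution.

(** * Bernoulli numbers *)

Lemma size_bernoulli_seq n : size (bernoulli_seq n) = n.+1.
Proof. by elim: n => //= n IH; rewrite size_rcons IH. Qed.

Lemma nth_bernoulli_seq n j : (j <= n)%N -> (bernoulli_seq n)`_j = bernoulli j.
Proof.
elim: n => [|n IH]; first by case: j.
rewrite leq_eqVlt => /predU1P[-> //|jn].
by rewrite /= nth_rcons size_bernoulli_seq jn IH.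
Qed.

Lemma bernoulli_rec n :
  \sum_(j < n.+2) 'C(n.+2, j)%:R * bernoulli j = 0.
Proof.
rewrite big_ord_recr /= {2}/bernoulli /= nth_rcons size_bernoulli_seq ltnn eqxx.
rewrite binSn mulrCA mulfV ?rat_char0 // mulr1.
apply/eqP; rewrite subr_eq0; apply/eqP; apply: eq_bigr => j _.
by rewrite nth_bernoulli_seq // -ltnS.
Qed.

Definition bernoulli_fact k : rat := bernoulli k / k`!%:R.

Lemma bernoulli_fact0 : bernoulli_fact 0 = 1.
Proof. by rewrite /bernoulli_fact divr1. Qed.

Lemma bernoulli_fact1 : bernoulli_fact 1 = - 2^-1.
Proof.
by rewrite /bernoulli_fact divr1 /bernoulli /= big_ord1 mul1r mulNr mul1r.
Qed.

(** For s >= 2 this is the defining recurrence divided by s!; at s = 1 the recurrence does not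
    apply, and B_0 = 1 remains. *)
Lemma bernoulli_fact_sum s :
  \sum_(k < s.+1) bernoulli_fact k / (s - k)`!%:R =
    bernoulli_fact s + (s == 1)%:R.
Proof.
case: s => [|[|s]].
- by rewrite big_ord1 divr1 addr0.
- by rewrite !big_ord_recl big_ord0 bernoulli_fact0 addr0 addrC divr1.
rewrite big_ord_recr /= subnn divr1 addr0 addrC -[RHS]addr0; congr (_ + _).
transitivity ((s.+2)`!%:R^-1 * \sum_(j < s.+2) 'C(s.+2, j)%:R * bernoulli j).
  rewrite mulr_sumr.
  apply: eq_bigr => k _; have ks : (k <= s.+2)%N by rewrite ltnW // ltnS ltnW.
  rewrite -(bin_fact ks) !natrM /bernoulli_fact; field.
  have := rat_char0 (s.+2)`!.-1.
  rewrite prednK ?fact_gt0 // -(bin_fact ks) !natrM !mulf_eq0 !negb_or.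
  by case/andP=> /[swap] /andP[-> ->] ->.
by rewrite bernoulli_rec mulr0.
Qed.

Lemma bernoulli_fact2 : bernoulli_fact 2 = 12^-1.
Proof.
have := bernoulli_fact_sum 3; rewrite big_ord_recr /= divr1 addr0.
rewrite -[RHS]add0r => /addIr; rewrite !big_ord_recr big_ord0 /= divr1.
rewrite bernoulli_fact0 bernoulli_fact1 add0r => /eqP.
by rewrite addrC addr_eq0 => /eqP ->.
Qed.

(** * The functions Li_m in Q(z) and the substitution of 1/(1-z) *)

Definition Li (m : nat) : Qz := if m is m'.+2 then Lineg m' else 0.

Definition tz : Qz := z / (1 - z).

Definition zddz (f : Qz) : Qz := z * ddz f.

Fact zddz_is_zmod_morphism : zmod_morphism zddz.
Proof. by move=> f g; rewrite /zddz raddfB /= mulrBr. Qed.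
HB.instance Definition _ := GRing.isZmodMorphism.Build Qz Qz zddz
  zddz_is_zmod_morphism.

Lemma zddzM f g : zddz (f * g) = zddz f * g + f * zddz g.
Proof. by rewrite /zddz ddzM mulrDr mulrA [z * (f * _)]mulrCA. Qed.

Lemma z_neq0 : z != 0.
Proof. by rewrite tofrac_eq0 polyX_eq0. Qed.

Lemma z_neq1 : 1 - z != 0.
Proof.
rewrite subr_eq0 -tofrac1 tofrac_eq.
apply/eqP => /(congr1 (fun p : {poly rat} => p`_1)).
by rewrite coefX -(rmorph1 polyC) coefC.
Qed.

Lemma tz_neq0 : tz != 0.
Proof. exact: mulf_neq0 z_neq0 (invr_neq0 z_neq1). Qed.

Lemma zddz_tz : zddz tz = (1 + tz) * tz.
Proof.
have e : tz * (1 - z) = z by rewrite divfK ?z_neq1.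
have := congr1 zddz e; rewrite zddzM raddfB /=.
have -> : zddz 1 = 0 by rewrite /zddz -(rmorph1 ratQz) ddz_ratQz mulr0.
have -> : zddz z = z by rewrite /zddz ddz_z mulr1.
rewrite sub0r mulrN => /eqP; rewrite subr_eq => /eqP e'.
by apply: (mulIf z_neq1); rewrite e' -[RHS]mulrA e mulrDl mul1r.
Qed.

Lemma inv1B (F : fieldType) (x : F) :
  1 - x != 0 -> 1 / (1 - x) = 1 + x / (1 - x).
Proof. by move=> x1; field. Qed.

Lemma tz_inv : 1 / (1 - z) = 1 + tz.
Proof. exact: inv1B z_neq1. Qed.

Lemma tz_neqN1 : 1 + tz != 0.
Proof.
rewrite -tz_inv; exact: mulf_neq0 (oner_neq0 _) (invr_neq0 z_neq1).
Qed.

Lemma ddz_tz_neq0 : ddz tz != 0.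
Proof.
have := mulf_neq0 tz_neqN1 tz_neq0; rewrite -zddz_tz.
by apply: contra_neq => e; rewrite /zddz e mulr0.
Qed.

(** Having nonzero derivative, 1/(1-z) is transcendental over Q, which makes [zphi] a field
    morphism. *)
Lemma ddz_zinv_neq0 : ddz (1 / (1 - z)) != 0.
Proof.
rewrite tz_inv raddfD /= -(rmorph1 ratQz) ddz_ratQz add0r.
exact: ddz_tz_neq0.
Qed.

Definition zphi : Qz -> Qz := zsubst (1 / (1 - z)).

HB.instance Definition _ := GRing.isZmodMorphism.Build Qz Qz zphi
  (zsubstB ddz_zinv_neq0).
HB.instance Definition _ := GRing.isMonoidMorphism.Build Qz Qz zphi
  (zsubstM ddz_zinv_neq0).

Lemma zphiD f g : zphi (f + g) = zphi f + zphi g.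
Proof. exact: rmorphD. Qed.
Lemma zphiM f g : zphi (f * g) = zphi f * zphi g.
Proof. exact: rmorphM. Qed.

Lemma zphi_ratQz a : zphi (ratQz a) = ratQz a.
Proof. exact: zsubst_ratQz ddz_zinv_neq0 a. Qed.

Lemma zphi_peval s p : zphi (peval s p) = peval (zphi s) p.
Proof.
elim/poly_ind: p => [|p c IH]; first by rewrite !raddf0.
by rewrite !(pevalD, pevalM, pevalX, pevalC) zphiD zphiM IH zphi_ratQz.
Qed.

Lemma zphi_tz : zphi tz = - 1 - tz^-1.
Proof.
rewrite /tz fmorph_div rmorphB rmorph1 /= [zphi z](zsubst_z ddz_zinv_neq0).
rewrite tz_inv -/tz opprD addrA subrr sub0r.
by rewrite invrN mulrN mulrDl mul1r mulfV ?tz_neq0 // opprD addrC.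
Qed.

Lemma zddz_zphi f : zddz (zphi f) = tz * zphi (zddz f).
Proof.
have e : z * ddz (1 / (1 - z)) = tz * (1 / (1 - z)).
  rewrite tz_inv raddfD /= -{1}(rmorph1 ratQz) ddz_ratQz add0r.
  by rewrite -/(zddz tz) zddz_tz mulrC.
have zz : zphi z = 1 / (1 - z) := zsubst_z ddz_zinv_neq0.
rewrite {2}/zddz (rmorphM zphi) /= zz mulrA -e /zddz -mulrA; congr (_ * _).
exact: ddz_zsubst ddz_zinv_neq0 f.
Qed.

Lemma Li2 : Li 2 = tz. Proof. by []. Qed.
Lemma zddz_Li m : zddz (Li m.+2) = Li m.+3. Proof. by []. Qed.
Lemma Li3 : Li 3 = Li 2 * (1 + Li 2).
Proof. by rewrite -zddz_Li Li2 zddz_tz mulrC. Qed.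

(** [peval tz] identifies the polynomials in Li_0 with [{poly rat}]; Li_0 takes
    the value -1 at z = oo and 0 at z = 0. *)
Lemma Li_peval m : exists p : {poly rat},
  [/\ Li m = peval tz p, p.[0] = 0 & p.[-1] = if m == 2 then -1 else 0].
Proof.
case: m => [|[|m]].
- by exists 0; rewrite raddf0 !horner0.
- by exists 0; rewrite raddf0 !horner0.
elim: m => [|m [p [e p0 p1]]].
  by exists 'X; rewrite pevalX !hornerX.
(* On polynomials in t = Li_0 the operator D is t (1 + t) d/dt, whose values vanish at both t = 0
   and t = -1. *)
exists (p^`() * ((1 + 'X) * 'X)); split.
- rewrite -zddz_Li e /zddz ddz_peval [LHS]mulrA -[z * ddz tz]/(zddz tz) zddz_tz mulrC.
  by rewrite !(rmorphM, rmorphD, rmorph1) /= pevalX.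
- by rewrite !hornerM hornerX !mulr0.
- by rewrite !hornerM hornerD hornerX hornerC subrr mul0r mulr0.
Qed.

(** * Values at z = oo *)

(** [lim f a] says that f is regular at z = oo, i.e. at Li_0(z) = -1, and takes
    the value a there. *)
Definition lim (f : Qz) (a : rat) : Prop := exists p q : {poly rat},
  [/\ q.[-1] != 0, f * peval tz q = peval tz p & p.[-1] = a * q.[-1]].

Lemma limD f a g b : lim f a -> lim g b -> lim (f + g) (a + b).
Proof.
case=> [p [q [q0 e ea]]] [p' [q' [q'0 e' eb]]].
exists (p * q' + p' * q), (q * q'); rewrite !(hornerM, hornerD) mulf_neq0 //.
split=> //; last by rewrite ea eb; ring.
rewrite !(rmorphD, rmorphM) /= -e -e' mulrDl; congr (_ + _); rewrite ?mulrA //.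
by rewrite mulrAC -!mulrA; congr (_ * _); rewrite mulrC.
Qed.

Lemma limM f a g b : lim f a -> lim g b -> lim (f * g) (a * b).
Proof.
case=> [p [q [q0 e ea]]] [p' [q' [q'0 e' eb]]].
exists (p * p'), (q * q'); rewrite !hornerM mulf_neq0 //.
by rewrite ea eb !rmorphM /= -e -e' mulrACA; split=> //; rewrite mulrACA.
Qed.

Lemma lim_ratQz a : lim (ratQz a) a.
Proof.
exists a%:P, 1; rewrite !hornerC mulr1 rmorph1 mulr1 pevalC.
by split=> //; exact: oner_neq0.
Qed.

Lemma lim0 : lim 0 0.
Proof. by rewrite -(raddf0 ratQz); exact: lim_ratQz. Qed.
Lemma lim1 : lim 1 1.
Proof. by rewrite -(rmorph1 ratQz); exact: lim_ratQz. Qed.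
Lemma limN f a : lim f a -> lim (- f) (- a).
Proof.
rewrite -mulN1r -[- a]mulN1r; apply: limM.
by rewrite -(rmorphN1 ratQz); exact: lim_ratQz.
Qed.
Lemma lim_nat n : lim n%:R n%:R.
Proof. by rewrite -(rmorph_nat ratQz); exact: lim_ratQz. Qed.
Lemma lim_inv_nat n : lim n%:R^-1 n%:R^-1.
Proof. by rewrite -(rmorph_nat ratQz) -fmorphV; exact: lim_ratQz. Qed.
Lemma limX f a n : lim f a -> lim (f ^+ n) (a ^+ n).
Proof.
by move=> fa; elim: n => [|n IH]; [exact: lim1 | rewrite !exprS; exact: limM].
Qed.
Lemma lim_sum (I : Type) (r : seq I) (P : pred I) (F : I -> Qz) (G : I -> rat) :
  (forall i, P i -> lim (F i) (G i)) ->
  lim (\sum_(i <- r | P i) F i) (\sum_(i <- r | P i) G i).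
Proof. by move=> FG; elim/big_ind2: _ => //; [exact: lim0 | move=> *; exact: limD]. Qed.

Lemma lim_horner f a p : lim f a -> lim (peval f p) p.[a].
Proof.
move=> fa; elim/poly_ind: p => [|p c IH].
  by rewrite raddf0 horner0; exact: lim0.
rewrite hornerMXaddC rmorphD rmorphM /= pevalX pevalC.
by apply: limD; [exact: limM | exact: lim_ratQz].
Qed.

Lemma lim_tz : lim tz (-1).
Proof.
exists 'X, 1; rewrite hornerX hornerC rmorph1 pevalX !mulr1.
by split=> //; exact: oner_neq0.
Qed.

Lemma lim_tzV : lim tz^-1 (-1).
Proof.
by exists 1, 'X; rewrite hornerX hornerC rmorph1 pevalX mulVf ?tz_neq0 //.
Qed.

(** A constant a with a q(t) = p(t) in Q(z) satisfies a q = p as polynomials, t being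
    transcendental; at -1 this gives a q(-1) = 0. *)
Lemma lim_const_eq0 f : lim f 0 -> zddz f = 0 -> f = 0.
Proof.
move=> [p [q [q0 e p0]]] /eqP; rewrite mulf_eq0 (negbTE z_neq0) /= => /eqP.
move=> /ddz_eq0[a fa]; move: e; rewrite fa -(pevalC tz) -rmorphM /= => /eqP.
rewrite -subr_eq0 -raddfB /= => e.
have {e} : a%:P * q - p = 0.
  by apply/eqP; apply: contraTT e => e; apply: peval_neq0 => //; exact: ddz_tz_neq0.
move=> /(congr1 (fun p : {poly rat} => p.[-1])) /eqP.
rewrite hornerD hornerN hornerM hornerC horner0 p0 mul0r subr0.
by rewrite mulf_eq0 (negbTE q0) orbF => /eqP ->; rewrite pevalC raddf0.
Qed.

Definition lim_poly (p : {poly Qz}) (q : {poly rat}) := forall i, lim p`_i q`_i.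

Lemma lim_polyD p q p' q' : lim_poly p q -> lim_poly p' q' ->
  lim_poly (p + p') (q + q').
Proof. by move=> pq p'q' i; rewrite !coefD; exact: limD. Qed.
Lemma lim_polyN p q : lim_poly p q -> lim_poly (- p) (- q).
Proof. by move=> pq i; rewrite !coefN; exact: limN. Qed.
Lemma lim_polyM p q p' q' : lim_poly p q -> lim_poly p' q' ->
  lim_poly (p * p') (q * q').
Proof. by move=> pq p'q' i; rewrite !coefM; apply: lim_sum => j _; exact: limM. Qed.
Lemma lim_polyC f a : lim f a -> lim_poly f%:P a%:P.
Proof. by move=> fa i; rewrite !coefC; case: eqP => // _; exact: lim0. Qed.
Lemma lim_polyZ f a p q : lim f a -> lim_poly p q -> lim_poly (f *: p) (a *: q).
Proof. by move=> fa pq i; rewrite !coefZ; exact: limM. Qed.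
Lemma lim_polyXn n : lim_poly 'X^n 'X^n.
Proof. by move=> i; rewrite !coefXn; exact: lim_nat. Qed.
Lemma lim_poly0 : lim_poly 0 0.
Proof. by move=> i; rewrite !coef0; exact: lim0. Qed.
Lemma lim_poly_sum (I : Type) (r : seq I) (P : pred I) F G :
  (forall i : I, P i -> lim_poly (F i) (G i)) ->
  lim_poly (\sum_(i <- r | P i) F i) (\sum_(i <- r | P i) G i).
Proof.
by move=> FG; elim/big_ind2: _ => //; [exact: lim_poly0 | move=> *; exact: lim_polyD].
Qed.
Lemma lim_poly_derivn p q n : lim_poly p q -> lim_poly p^`(n) q^`(n).
Proof.
move=> pq i; rewrite !coef_derivn.
rewrite -[X in lim X _]mulr_natr -[X in lim _ X]mulr_natr.
exact: limM (pq _) (lim_nat _).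
Qed.

Lemma coef_comp_scale (K : fieldType) (c : K) p i :
  (p \Po (c *: 'X))`_i = c ^+ i * p`_i.
Proof.
elim/poly_ind: p i => [|p a IH] i; first by rewrite comp_poly0 !coef0 mulr0.
rewrite comp_poly_MXaddC -scalerAr !coefD coefZ !coefMX !coefC IH.
case: i => [|i] /=; first by rewrite mulr0 !add0r expr0 mul1r.
by rewrite !addr0 exprS mulrA.
Qed.

Lemma lim_poly_scale f a p q : lim f a -> lim_poly p q ->
  lim_poly (p \Po (f *: 'X)) (q \Po (a *: 'X)).
Proof.
by move=> fa pq i; rewrite !coef_comp_scale; exact: limM (limX i fa) (pq i).
Qed.

Lemma lim_poly_tau f a p q : lim f a -> lim_poly p q ->
  lim_poly (tau_poly f p) (tau_poly a q).
Proof.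
(* A polynomial and its limit may differ in size, so both sums are cut at a common bound. *)
move=> fa pq; pose N := maxn (size p) (size q).
rewrite !(@tau_polyE _ _ N) ?leq_maxl ?leq_maxr //.
apply: lim_poly_sum => j _; apply: lim_polyZ; last exact: lim_poly_derivn.
apply: limM (lim_inv_nat _); apply/limX/limM; first exact: limN.
exact: (lim_inv_nat 2).
Qed.

Definition lim_series (f : series {poly Qz}) (g : series {poly rat}) :=
  forall n, lim_poly (f n) (g n).

Lemma lim_seriesM f g f' g' : lim_series f g -> lim_series f' g' ->
  lim_series (f * f') (g * g').
Proof.
by move=> fg fg' n; rewrite !coefsM; apply: lim_poly_sum => i _; exact: lim_polyM.
Qed.

Lemma lim_series_const p q : lim_poly p q ->
  lim_series (series_const p) (series_const q).
Proof. by move=> pq [|n] //=; exact: lim_poly0. Qed.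

Lemma polyC_inv_nat (R : idomainType) n : (n%:R^-1)%:P = n%:R^-1 :> {poly R}.
Proof. by rewrite -polyCV rmorph_nat. Qed.

Lemma lim_poly_inv_nat n : lim_poly n%:R^-1 n%:R^-1.
Proof. by rewrite -!polyC_inv_nat; exact/lim_polyC/lim_inv_nat. Qed.

Lemma lim_seriesX f g m : lim_series f g -> lim_series (f ^+ m) (g ^+ m).
Proof.
move=> fg; elim: m => [|m IH]; last by rewrite !exprS; exact: lim_seriesM.
exact: lim_series_const (lim_polyC lim1).
Qed.

Lemma lim_sexp f g : lim_series f g -> lim_series (sexp f) (sexp g).
Proof.
move=> fg n; apply: lim_poly_sum => k _; rewrite !fps_powE.
exact: lim_polyM (lim_poly_inv_nat _) (lim_seriesX _ fg n).
Qed.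

Lemma lim_seriesD f g f' g' : lim_series f g -> lim_series f' g' ->
  lim_series (f + f') (g + g').
Proof. by move=> fg fg' n; rewrite !coefsD; exact: lim_polyD. Qed.

Lemma lim_hvar : lim_series hvar hvar.
Proof.
move=> n; rewrite -[hvar n]/((n == 1)%:R) -[X in lim_poly _ X]/((n == 1)%:R).
case: (n == 1); [exact: lim_polyC lim1 | exact: lim_poly0].
Qed.

Lemma lim_kconst f a : lim f a -> lim_series (kconst _ f) (kconst _ a).
Proof. by move=> fa; apply/lim_series_const/lim_polyC. Qed.

Lemma lim_xvar : lim_series (xvar _) (xvar _).
Proof. exact: lim_series_const (lim_polyXn 1). Qed.

Lemma lim_gexp f a g b : lim f a -> lim g b -> lim_series (gexp f g) (gexp a b).
Proof.
move=> fa gb; apply/lim_sexp/lim_seriesM; first exact: lim_hvar.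
apply: lim_seriesD; apply: lim_seriesM; first exact: lim_kconst.
- exact: lim_xvar.
- exact: lim_kconst.
- exact: lim_hvar.
Qed.

Lemma lim_psi_series L L' b b' :
    (forall m, lim (L m) (L' m)) -> (forall k, lim (b k) (b' k)) ->
  lim_series (psi_series L b) (psi_series L' b').
Proof.
move=> LL bb; apply: lim_sexp => n.
rewrite -[psi_arg _ _ _]/(exponent0 L b n.+2 + _).
rewrite -[psi_arg _ _ _]/(exponent0 L' b' n.+2 + _).
rewrite !exponent0_coef; apply: lim_polyD.
  apply/lim_polyN/lim_poly_sum => k _; apply: lim_polyZ (lim_polyXn _).
  exact: limM (bb _) (limM (LL _) (lim_inv_nat _)).
case: ifP => _; last exact: lim_poly0.
exact: lim_polyZ (limM (LL 2) (lim_inv_nat 2)) (lim_polyXn _).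
Qed.

Lemma kmap_psi_series (K : fieldType) (char0 : forall n, n.+1%:R != 0 :> K)
    (phi : {rmorphism K -> K}) (L b : nat -> K) : L 1 = 0 -> b 0 = 1 ->
  kmap phi (psi_series L b) = psi_series (phi \o L) (phi \o b).
Proof.
move=> L1 b0.
have -> : psi_series (phi \o L) (phi \o b) = sexp (kmap phi (psi_arg L b)).
  congr sexp; apply: seriesP => n; rewrite smapE.
  rewrite -[psi_arg _ _ _]/(exponent0 (phi \o L) (phi \o b) n.+2 + _).
  rewrite -[psi_arg _ _ _]/(exponent0 L b n.+2 + _) !exponent0_coef.
  rewrite rmorphD rmorphN rmorph_sum; congr (- _ + _) => /=.
    apply: eq_bigr => k _; rewrite map_polyZ map_polyXn.
    by rewrite rmorphM fmorph_div rmorph_nat.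
  case: ifP => _; last by rewrite rmorph0.
  by rewrite map_polyZ map_polyXn fmorph_div rmorph_nat.
have nU := poly_natU char0.
have a0 := psi_arg0 L1 b0.
apply: (sexp_uniq nU); first by rewrite smapE a0 rmorph0.
  by rewrite smapE psi_series0 rmorph1.
by rewrite theta_kmap (theta_sexp nU) // rmorphM /= -theta_kmap.
Qed.

Lemma psi_series_Li_0 (K : fieldType) (char0 : forall n, n.+1%:R != 0 :> K)
  (b : nat -> K) : psi_series (fun=> 0) b = 1.
Proof.
symmetry; apply: (sexp_uniq (poly_natU char0)) => //.
  rewrite -[LHS]/(exponent0 (fun=> 0) b 2 + _) exponent0_coef big1 => [|k _].
    by rewrite mul0r scale0r oppr0 addr0.
  by rewrite mul0r mulr0 scale0r.
rewrite theta_const mulr1; apply: seriesP => n; rewrite thetaE.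
rewrite -[psi_arg _ _ _]/(exponent0 (fun=> 0) b n.+2 + _) exponent0_coef.
rewrite big1 => [|k _]; last by rewrite mul0r mulr0 scale0r.
by rewrite mul0r scale0r if_same oppr0 addr0 mul0rn.
Qed.

(** At z = oo, all the Li_m with m < 0 vanish and Li_0 = -1. *)
Lemma psi_series_Li_oo :
  psi_series (fun m => if m == 2 then -1 else 0) bernoulli_fact =
  gexp (- 2^-1) 12^-1.
Proof.
congr sexp; apply: seriesP => -[|n].
  by rewrite gexp_arg0 psi_arg0 // bernoulli_fact0.
rewrite -[LHS]/(exponent0 _ _ n.+3 + 0) addr0 exponent0_coef.
rewrite /gexp_arg hvarMS coefsD !kconstM_coef.
(* Only k + l = 2 contributes, and psi keeps the pairs (1, 1), giving -x/2 in degree 1, and (2, 0),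
   giving B_2 / 2! = 1/12 in degree 2. *)
case: n => [|[|n]].
- rewrite big_mkcond !big_ord_recl big_ord0 /bump /= bernoulli_fact1.
  rewrite !mul0r !mulr0 scale0r add0r !addr0 divr1 mulrN1 opprK.
  by rewrite mul_polyC scaleNr.
- rewrite big_mkcond !big_ord_recl big_ord0 /bump /= bernoulli_fact2.
  rewrite !mul0r !mulr0 !scale0r !add0r addr0 divr1 mulrN1 scaleNr opprK.
  by rewrite alg_polyC mulr1.
rewrite big1 => [|k kn]; last first.
  rewrite ifF ?mul0r ?mulr0 ?scale0r //.
  by apply/negbTE/eqP => e; rewrite -addnn in kn; have := ltn_ord k; lia.
by rewrite /= !mulr0 oppr0 addr0.
Qed.

Lemma gexp_argx (K : fieldType) (a : K) :
  gexp_arg a 0 =1 fps_monom 1 (a *: 'X).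
Proof.
move=> [|[|n]]; first by rewrite gexp_arg0.
  by rewrite hvarMS coefsD !kconstM_coef mul0r addr0 mul_polyC.
by rewrite hvarMS coefsD !kconstM_coef mul0r addr0 mulr0.
Qed.

Lemma gexp_argh (K : fieldType) (b : K) : gexp_arg 0 b =1 fps_monom 2 b%:P.
Proof.
move=> [|[|[|n]]]; first by rewrite gexp_arg0.
- by rewrite hvarMS coefsD !kconstM_coef mul0r mulr0 addr0.
- by rewrite hvarMS coefsD !kconstM_coef mul0r add0r mulr1.
- by rewrite hvarMS coefsD !kconstM_coef mul0r add0r mulr0.
Qed.

(** * The Gaussian average in the shifted variable *)

Section ShiftedEvaluation.
Variables (K : fieldType) (y : {poly {poly K}}) (c : K).
Hypotheses (dy : y^`() = 1) (y0 : y.[0] = c *: 'X).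

(** Two properties of y + t x suffice: its derivative 1 turns d/dy after the substitution into d/dx
    before it, and its value at y = 0 turns the evaluation there into a rescaling of x. *)
Definition eval_at : {rmorphism {poly K} -> {poly {poly K}}} :=
  horner_eval y \o map_poly (polyC \o polyC).

Lemma eval_atC a : eval_at a%:P = a%:P%:P.
Proof. by rewrite /= /horner_eval map_polyC hornerC. Qed.

Lemma eval_atX : eval_at 'X = y.
Proof. by rewrite /= /horner_eval map_polyX hornerX. Qed.

Lemma eval_at_half : eval_at (2^-1 *: 'X) = y / 2.
Proof.
by rewrite -mul_polyC rmorphM eval_atX eval_atC !polyC_inv_nat mulrC.
Qed.

Lemma eval_at_map (phi : {rmorphism K -> K}) p :
  (map_poly (fun a => (phi a)%:P%:P) p).[y] = eval_at (map_poly phi p).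
Proof. by rewrite /= /horner_eval -map_poly_comp. Qed.

Lemma deriv_eval_at p : (eval_at p)^`() = eval_at p^`().
Proof.
elim/poly_ind: p => [|p a IH]; first by rewrite raddf0 !linear0 raddf0.
rewrite derivMXaddC !rmorphD !rmorphM eval_atX eval_atC derivD derivM derivC.
by rewrite addr0 IH dy mulr1 addrC.
Qed.

Lemma derivn_eval_at p n : (eval_at p)^`(n) = eval_at p^`(n).
Proof. by elim: n => // n IH; rewrite !derivnS IH deriv_eval_at. Qed.

Lemma horner0_eval_at p : (eval_at p).[0] = p \Po (c *: 'X).
Proof.
elim/poly_ind: p => [|p a IH]; first by rewrite raddf0 horner0 comp_poly0.
rewrite rmorphD rmorphM eval_atX eval_atC hornerD hornerM IH hornerC.
by rewrite comp_poly_MXaddC y0.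
Qed.

End ShiftedEvaluation.

Lemma gauss_opE lambda N (p : {poly {poly Qz}}) : (size p <= N)%N -> gauss_op lambda p =
  \sum_(j < N) ((2 * lambda) ^- j / j`!%:R)%:P *: p^`(j.*2).
Proof.
move=> pN; rewrite /gauss_op.
rewrite (big_ord_widen N
  (fun j => ((2 * lambda) ^- j / j`!%:R)%:P *: p^`(j.*2)) pN).
rewrite big_mkcond; apply: eq_bigr => j _ /=; case: ifP => // /negbT.
rewrite -leqNgt => pj; rewrite derivn_poly0 ?scaler0 //.
by rewrite (leq_trans pj) // -addnn leq_addr.
Qed.

Lemma deriv_yshift : yshift^`() = 1.
Proof. by rewrite derivD derivX derivC addr0. Qed.

Lemma yshift0 : yshift.[0] = tz *: 'X.
Proof. by rewrite hornerD hornerX hornerC add0r. Qed.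

Lemma two_lambda_inv (F : fieldType) (x : F) : (2 : F) != 0 -> x != 0 ->
  1 - x != 0 -> (2 * (1 - x^-1))^-1 = - (x / (1 - x)) / 2.
Proof. by move=> two x0 x1; field; rewrite two x0 x1 -opprB oppr_eq0 x1. Qed.

Lemma gauss_eval_at f n :
  gauss (1 - z^-1) (fun n => eval_at yshift (f n)) n =
    tau_poly tz (f n) \Po (tz *: 'X).
Proof.
rewrite /gauss; move: (f n) => {f} p.
pose N := maxn (size p) (size (eval_at yshift p)).
rewrite (@gauss_opE _ N) ?leq_maxr // (@tau_polyE _ tz N) ?leq_maxl //.
rewrite horner_sum raddf_sum; apply: eq_bigr => j _.
rewrite (derivn_eval_at deriv_yshift) hornerZ.
rewrite (horner0_eval_at yshift0) mul_polyC /= comp_polyZ.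
rewrite -exprVn; congr (_ ^+ _ / _ *: _).
exact: two_lambda_inv (Qz_char0 1) z_neq0 z_neq1.
Qed.

Lemma fps_pow_map (A B : comUnitRingType) (phi : {rmorphism A -> B}) (f : fps A) k :
  fps_pow (fun n => phi (f n)) k =1 fun n => phi (fps_pow f k n).
Proof.
elim: k => [|k IH] n.
  by rewrite /= /fps_monom; case: eqP; rewrite ?rmorph1 ?rmorph0.
by rewrite /= /fps_mul rmorph_sum; apply: eq_bigr => i _; rewrite rmorphM IH.
Qed.

Lemma fps_exp_map (A B : comUnitRingType) (phi : {rmorphism A -> B}) (f : fps A) :
    (forall n, n.+1%:R \is a @GRing.unit A) ->
  fps_exp (fun n => phi (f n)) =1 fun n => phi (fps_exp f n).
Proof.
move=> nU n; rewrite /fps_exp rmorph_sum; apply: eq_bigr => k _.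
rewrite rmorphM rmorphV ?factU // rmorph_nat; congr (_ * _).
exact: fps_pow_map.
Qed.

(** * The series of the theorem *)

Definition bernoulliQz : nat -> Qz := ratQz \o bernoulli_fact.

Lemma bernoulliQzE k : bernoulliQz k = ratQz (bernoulli_fact k).
Proof. by []. Qed.

Lemma bernoulliQz0 : bernoulliQz 0 = 1.
Proof. by rewrite bernoulliQzE bernoulli_fact0 rmorph1. Qed.

Lemma bernoulliQz1 : bernoulliQz 1 = - 2^-1.
Proof.
rewrite bernoulliQzE bernoulli_fact1 (rmorphN ratQz) (fmorphV ratQz).
by rewrite (rmorph_nat ratQz).
Qed.

Definition psiQz : series {poly Qz} := psi_series Li bernoulliQz.

Lemma psi_exponentE : psi_exponent =1 psi_arg Li bernoulliQz.
Proof.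
move=> n; case: n => [|n].
  (* In degree 0 the strict bound excludes every pair with 2k + l = 2, whereas [psi_arg] vanishes
     there by cancellation. *)
  rewrite (psi_arg0 (erefl : Li 1 = 0) bernoulliQz0).
  rewrite /psi_exponent big1 ?oppr0 // => k _; rewrite big_pred0 // => l.
  by apply/negbTE/andP => -[+ /eqP e]; rewrite e.
rewrite -[RHS]/(exponent0 _ _ n.+3 + 0) addr0 exponent0_coef; congr (- _).
rewrite [RHS]big_mkcond; apply: eq_bigr => k _.
case: ifP => kn; last first.
  rewrite big_pred0 // => l; apply/negbTE/andP => -[_ /eqP e].
  by have := leq_addr l k.*2; rewrite e kn.
have ln : (n.+3 - k.*2 < n.+1.+3)%N by rewrite ltnS leq_subr.
(* For each k the condition 2k + l = n + 3 leaves a single l. *)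
rewrite (big_pred1 (Ordinal ln)) => [|l /=]; last first.
  rewrite -val_eqE /=; apply/andP/eqP => [[_ /eqP e]|->].
    by have := addKn k.*2 l; rewrite e.
  by rewrite subnKC.
have -> : (n.+3 - k = (k + (n.+3 - k.*2) - 2).+2)%N.
  by rewrite -addnn in kn *; lia.
have -> (m : nat) :
    ratQz (bernoulli k / (m * k`!)%N%:R) = bernoulliQz k / m%:R.
  rewrite bernoulliQzE natrM invfM [m%:R^-1 * _]mulrC mulrA (rmorphM ratQz).
  by rewrite (fmorphV ratQz) (rmorph_nat ratQz).
by rewrite -[Li _.+2]/(Lineg _) -mulrA [_^-1 * _]mulrC.
Qed.

Lemma psiE : psi =1 psiQz.
Proof. by move=> n; rewrite /psi (boolp.funext psi_exponentE). Qed.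

Lemma psiQz_eqs : dilog_eqs zddz tz psiQz.
Proof.
split.
  apply: (shift_psi_series Qz_char0 zddzM _ _ zddz_Li Li3 bernoulliQz0) => // s.
  rewrite -(rmorph_nat ratQz) -rmorphD -bernoulli_fact_sum rmorph_sum.
  by apply: eq_bigr => k _; rewrite fmorph_div rmorph_nat.
have bd k : zddz (bernoulliQz k) = 0.
  by rewrite /zddz bernoulliQzE ddz_ratQz mulr0.
exact: (dx_psi_series Qz_char0 zddzM (erefl : Li 0 = 0) (erefl : Li 1 = 0)
  zddz_Li bernoulliQz0 bernoulliQz1 bd).
Qed.

Lemma fourier_psiQz_eqs : dilog_eqs zddz tz (fourier zphi tz psiQz).
Proof.
have [s x] := psiQz_eqs; split.
  exact (shift_fourier Qz_char0 tz_neq0 zphi_tz s).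
exact (dx_fourier Qz_char0 zddzM tz_neq0 zddz_tz zphi_tz zddz_zphi x).
Qed.

Lemma lim_bernoulliQz k : lim (bernoulliQz k) (bernoulli_fact k).
Proof. exact: lim_ratQz. Qed.

Lemma lim_psiQz : lim_series psiQz (gexp (- 2^-1) 12^-1).
Proof.
rewrite -psi_series_Li_oo; apply: lim_psi_series lim_bernoulliQz => m.
have [p [-> _ <-]] := Li_peval m; exact: lim_horner lim_tz.
Qed.

(** The value -1 - 1/t of Li_0 at 1/(1-z) tends to 0 as t tends to -1, and every Li_m kept in psi is
    a polynomial in Li_0 without constant term. *)
Lemma lim_kmap_psiQz : lim_series (kmap zphi psiQz) 1.
Proof.
rewrite (kmap_psi_series Qz_char0 _ (erefl : Li 1 = 0) bernoulliQz0).
rewrite -(psi_series_Li_0 rat_char0 bernoulli_fact).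
apply: lim_psi_series => [m|k]; last first.
  rewrite /= bernoulliQzE zphi_ratQz.
  exact: lim_ratQz.
have [p [e p0 _]] := Li_peval m; rewrite /= e.
rewrite zphi_peval -p0; apply: lim_horner; rewrite zphi_tz.
rewrite -[X in lim _ X](subrr (-1 : rat)); apply: limD; first exact/limN/lim1.
exact/limN/lim_tzV.
Qed.

(** At t = -1 the Gaussian operator sends e^{xh/2} to e^{xh/2 + hbar/8}, and the rescaling changes
    the sign of x. The constant 24 of the theorem comes from 1/8 - 1/24 = 1/12, where 1/12 is B_2 /
    2!. *)
Lemma lim_fourier_psiQz :
  lim_series (fourier zphi tz psiQz) (gexp (- 2^-1) 12^-1).
Proof.
have -> : gexp (- 2^-1) 12^-1 = gexp 0 (- 24^-1) *
    scale (-1) (tau (-1) (gexp 2^-1 0 * 1)) :> series {poly rat}.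
  rewrite (tau_gexp rat_char0).
  have -> : tau (-1) 1 = 1 :> series {poly rat}.
    by rewrite -(rmorph1 (kconst _)) tau_kconst.
  rewrite (shift_one rat_char0) mulr1 (scale_gexp rat_char0) (gexpD rat_char0).
  exact: eq_gexp.
apply: lim_seriesM => [|n].
  apply: lim_gexp; first exact: lim0.
  exact: limN (lim_inv_nat 24).
apply: lim_poly_scale lim_tz _; apply: lim_poly_tau lim_tz _.
apply: lim_seriesM lim_kmap_psiQz _.
by apply: lim_gexp lim0; exact: (lim_inv_nat 2).
Qed.

Lemma psiQz_fourier : psiQz = fourier zphi tz psiQz.
Proof.
apply/eqP; rewrite -subr_eq0; apply/eqP.
apply: (dilog_eqs_eq0 Qz_char0 zddz_tz lim_const_eq0).
  exact: dilog_eqsB psiQz_eqs fourier_psiQz_eqs.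
move=> n i; rewrite coefsD coefsN coefD coefN.
rewrite -[X in lim _ X](subrr ((gexp (- 2^-1) 12^-1 n)`_i)).
exact: limD (lim_psiQz n i) (limN (lim_fourier_psiQz n i)).
Qed.

Lemma psi_at_yshift n :
  psi_at yshift (1 / (1 - z)) n = eval_at yshift (kmap zphi psiQz n).
Proof.
rewrite /psi_at psiE -[kmap _ _ n]/(map_poly zphi (psiQz n)).
move: (psiQz n) => p; exact (eval_at_map yshift zphi p).
Qed.

Lemma exp_yshift n :
  fps_exp (fps_monom 1 (yshift / 2)) n = eval_at yshift (gexp 2^-1 0 n).
Proof.
rewrite -eval_at_half -[gexp _ _ n]/(fps_exp (gexp_arg 2^-1 0) n).
rewrite (boolp.funext (gexp_argx _)) -fps_exp_map; last exact: poly_natU Qz_char0.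
congr (fps_exp _ n); apply: boolp.funext => m; rewrite /fps_monom.
by case: (m == 1); rewrite ?raddf0.
Qed.

Lemma exp_hbar n :
  fps_exp (fps_monom 2 (- 24^-1 : {poly Qz})) n = gexp 0 (- 24^-1) n.
Proof.
rewrite -[gexp _ _ n]/(fps_exp (gexp_arg 0 (- 24^-1)) n).
rewrite (boolp.funext (gexp_argh _)); congr (fps_exp (fps_monom 2 _) n).
by rewrite polyCN polyC_inv_nat.
Qed.

Theorem theorem3p4 :
  psi =1
  fps_mul
    (fps_exp (fps_monom 2 (- 24^-1 : {poly Qz})))
    (gauss (1 - z^-1)
       (fps_mul
          (fps_exp (fps_monom 1 (yshift / 2)))
          (psi_at yshift (1 / (1 - z))))).
Proof.
move=> n; rewrite psiE psiQz_fourier /fourier coefsM.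
apply: eq_bigr => i _; rewrite exp_hbar; congr (_ * _).
rewrite scaleE tauE -gauss_eval_at; congr (gauss_op _ _).[0].
rewrite coefsM rmorph_sum; apply: eq_bigr => j _.
by rewrite rmorphM exp_yshift psi_at_yshift.
Qed.
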